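(* Let $d \ge 1$ be an integer. Every function $\psi \in \Psi_d$ admits a continuous derivative of order $[(d-1)/2]$ on the open interval $(0,\pi)$.
   Context: For a real number $c$, $[c]$ denotes the greatest integer less than or equal to $c$. For an integer $d\ge 1$, $\mathbb{S}^d = \{x \in \mathbb{R}^{d+1} : \lVert x\rVert = 1\}$ with geodesic distance $\theta(u,v) = \arccos(\langle u,v\rangle) \in [0,\pi]$. A function $f:\mathbb{S}^d\times\mathbb{S}^d \to \mathbb{R}$ is positive definite if $\sum_{i=1}^n\sum_{j=1}^n c_i c_j f(u_i,u_j) \ge 0$ for all finite sets of points $u_1,\dots,u_n \in \mathbb{S}^d$ and all $c_1,\dots,c_n \in \mathbb{R}$. The class $\Psi_d$ consists of all continuous functions $\psi:[0,\pi]\to\mathbb{R}$ with $\psi(0)=1$ such that $(u,v)\mapsto\psi(\theta(u,v))$ is positive definite on $\mathbb{S}^d\times\mathbb{S}^d$. A continuous derivative of order $0$ means continuity. *)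

(* Defs.v *)
From mathcomp Require Import all_boot all_order all_algebra.
From mathcomp Require Import all_classical all_reals all_analysis.

Set Implicit Arguments.
Unset Strict Implicit.
Unset Printing Implicit Defensive.

Import Order.TTheory GRing.Theory Num.Theory.
Import numFieldNormedType.Exports.

Local Open Scope ring_scope.
Local Open Scope classical_set_scope.

Definition inner (R : realType) (m : nat) (u v : 'rV[R]_m) : R :=
  \sum_(i < m) u ord0 i * v ord0 i.

(* The library norm `|u| on 'rV[R]_m is the sup norm, hence the explicit
   Euclidean norm. *)
Definition enorm (R : realType) (m : nat) (u : 'rV[R]_m) : R :=
  Num.sqrt (inner u u).

Definition sphere (R : realType) (d : nat) : set 'rV[R]_d.+1 :=
  [set u | enorm u = 1].

Definition geodist (R : realType) (d : nat) (u v : 'rV[R]_d.+1) : R :=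
  acos (inner u v).

(* The points may repeat; merging the coefficients of equal points shows that
   this is the same as quantifying over pairwise distinct points. *)
Definition positive_definite (R : realType) (d : nat)
    (f : 'rV[R]_d.+1 -> 'rV[R]_d.+1 -> R) : Prop :=
  forall (n : nat) (u : 'I_n -> 'rV[R]_d.+1) (c : 'I_n -> R),
    (forall i, sphere (u i)) ->
    0 <= \sum_(i < n) \sum_(j < n) c i * c j * f (u i) (u j).

(* A function on [0, pi] is represented by a total function R -> R of which
   only the values on [0, pi] are constrained. *)
Definition Psi (R : realType) (d : nat) (psi : R -> R) : Prop :=
  [/\ {within `[0, pi], continuous psi},
      psi 0 = 1 &
      positive_definite (fun u v : 'rV[R]_d.+1 => psi (geodist u v))].

(* derive1n is total (with junk values where f is not differentiable), so
   differentiability of the lower-order derivatives is required explicitly. *)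
Definition has_continuous_derivative (R : realType) (k : nat) (a b : R)
    (f : R -> R) : Prop :=
  (forall j : nat, (j < k)%N -> {in `]a, b[, forall x, derivable f^`(j) x 1}) /\
  {in `]a, b[, continuous f^`(k)}.

(* Main.v *)
Require Import Defs.
From mathcomp Require Import all_boot all_order all_algebra.
From mathcomp Require Import all_classical all_reals all_analysis.
From mathcomp Require Import ring lra zify.

(** Write g = psi o acos and k = (d - 1) / 2.  For k = 0 the claim is the
    continuity of psi.  For k > 0, restrict the kernel to the unit sphere of
    C^(k+1), which is a great subsphere of S^d.  As Schoenberg showed, a
    positive definite kernel g(<u,v>) on it is a convergent mixture of the
    polynomials T_m^(k), m >= k, with T_m the Chebyshev polynomials.  So g is
    the k-th derivative of a function G on [-1, 1] for which
      H(x) = G(cos x) = a_0 + 2 sum_(m > 0) a_m cos(m x),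
      a_m >= 0 for m >= k,   sum_m |a_m| m^(2k) < oo.
    The series makes H of class C^(2k).  Passing from G^(j)(cos x) to
    G^(j+1)(cos x) means one differentiation and one division by - sin x, so
    after k such steps psi(x) = g(cos x) is left with k derivatives on
    (0, pi) ([Cn_pd_profile]).

    Positivity of the a_m.  Let z be the first coordinate on C^(k+1).  By the
    Funk-Hecke theorem, integrating q(<u,v>) Re z(u)^n over the sphere gives a
    multiple of Re z(v)^n.  Computed on monomials, the multiplier is, up to a
    positive constant, the coefficient of index n + k of the k-fold primitive
    of q ([funk_hecke], [fcoef_fh_eigen]).  Positive definiteness of g, tested
    against Re z^n, makes it nonnegative ([fcoef_ge0_approx]).

    Summability.  Choose the primitive G vanishing to order k at 1.  Then
    |H(x)| <= C (1 - cos x)^k, so the 2k-th symmetric difference of H at 0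
    with step s is O(s^(2k)).  On the series this difference is
    sum_m a_m (2 (1 - cos(m s)))^k up to a constant, whose terms with m >= k
    are all nonnegative; s = 1/n bounds the sum of a_m m^(2k) over m < n
    ([fejer_limit_summable]).

    Everything is done by finite sums: sphere integrals become averages over
    explicit finite families of points, g becomes a uniform limit of
    polynomials q_N whose k-fold primitives and Fourier coefficients converge,
    and H is recovered from its coefficients by Fejer means. *)

Set Implicit Arguments.
Unset Strict Implicit.
Unset Printing Implicit Defensive.
Import Order.TTheory GRing.Theory Num.Theory.
Import numFieldNormedType.Exports.
Local Open Scope ring_scope.

(** * Averages over equally spaced points of the circle *)

Section Circle.
Variable R : realType.
Implicit Types (x y t c : R) (f : R -> R) (p Q : {poly R}).

Definition avg (M : nat) f : R := M%:R^-1 * \sum_(i < M) f (pi *+ 2 * i%:R / M%:R).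

Lemma eq_avg M f g : f =1 g -> avg M f = avg M g.
Proof. by move=> e; rewrite /avg (eq_bigr _ (fun i _ => e _)). Qed.

Lemma avgD M f g : avg M (fun t => f t + g t) = avg M f + avg M g.
Proof. by rewrite /avg big_split mulrDr. Qed.

Lemma avgZ M c f : avg M (fun t => c * f t) = c * avg M f.
Proof. by rewrite /avg -mulr_sumr mulrCA. Qed.

Lemma avg_sum M (I : Type) (r : seq I) (P : pred I) (F : I -> R -> R) :
  avg M (fun t => \sum_(i <- r | P i) F i t) = \sum_(i <- r | P i) avg M (F i).
Proof. by rewrite /avg exchange_big mulr_sumr. Qed.

Lemma avg_cst M c : (0 < M)%N -> avg M (fun=> c) = c.
Proof.
move=> M0; rewrite /avg sumr_const card_ord -[c *+ _]mulr_natl mulrA mulVf ?mul1r //.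
by rewrite pnatr_eq0 -lt0n.
Qed.

Lemma avg_le M f g : (forall t, f t <= g t) -> avg M f <= avg M g.
Proof.
by move=> h; apply: ler_wpM2l; rewrite ?invr_ge0 // ler_sum.
Qed.

Lemma avg_norm M f : `|avg M f| <= avg M (fun t => `|f t|).
Proof.
rewrite /avg normrM ger0_norm ?invr_ge0 //.
by apply: ler_wpM2l; rewrite ?invr_ge0 // ler_norm_sum.
Qed.

(** The summands are differences of consecutive values of a sine, and the
    sum telescopes to zero by periodicity. *)
Lemma avg_cos M m c : (m < M)%N ->
  avg M (fun t => cos (m%:R * t + c)) = (m == 0)%:R * cos c.
Proof.
case: m => [|m] mM.
  by rewrite mul1r -[RHS](@avg_cst M) //; apply: eq_avg => t; rewrite mul0r add0r.
rewrite mul0r /avg; set h : R := pi * m.+1%:R / M%:R.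
have M0 : M%:R != 0 :> R by rewrite pnatr_eq0 -lt0n (leq_trans _ mM).
have sh : sin h != 0.
  apply/lt0r_neq0/sin_gt0_pi/andP; split.
    by rewrite /h !mulr_gt0 ?pi_gt0 ?invr_gt0 ?ltr0n // (leq_trans _ mM).
  by rewrite /h -mulrA gtr_pMr ?pi_gt0 // ltr_pdivrMr ?mul1r ?ltr_nat // ltr0n (leq_trans _ mM).
suff : (sin h *+ 2) * \sum_(i < M) cos (m.+1%:R * (pi *+ 2 * i%:R / M%:R) + c) = 0.
  move/eqP; rewrite mulf_eq0 mulrn_eq0 /= (negbTE sh) /= => /eqP ->.
  by rewrite mulr0.
rewrite mulr_sumr.
pose F (i : nat) := sin (h *+ 2 * i%:R + c - h).
rewrite (eq_bigr (fun i : 'I_M => F i.+1 - F i)); last first.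
  move=> i _; rewrite /F.
  have -> : m.+1%:R * (pi *+ 2 * i%:R / M%:R) + c = h *+ 2 * i%:R + c.
    by rewrite /h; field.
  have -> : h *+ 2 * i.+1%:R + c - h = (h *+ 2 * i%:R + c) + h.
    by rewrite -natr1; ring.
  by rewrite sinD sinB; ring.
rewrite -(big_mkord xpredT (fun i => F i.+1 - F i)) telescope_sumr // /F.
have -> : h *+ 2 * M%:R + c - h = (c - h) + (pi *+ 2) *+ m.+1.
  by rewrite /h -[in RHS]mulr_natr; field.
by rewrite periodicn ?mulr0 ?add0r ?subrr //; exact: sinD2pi.
Qed.

(** The coefficient of [cos ^+ j] at frequency [m]: the average of
    [cos t ^+ j * cos (m t)].  The recursion is
    2 cos t cos(m t) = cos((m + 1) t) + cos((m - 1) t), where for [m = 0] the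
    second frequency is 1 by parity. *)
Fixpoint cos_pow_coef (m j : nat) : R :=
  match j with
  | 0 => (m == 0)%:R
  | j'.+1 => (cos_pow_coef m.+1 j' + cos_pow_coef (if m is m'.+1 then m' else 1%N) j') / 2
  end.

Lemma cosMcos x y : cos x * cos y = (cos (y + x) + cos (y - x)) / 2.
Proof. by rewrite cosD cosB; field. Qed.

(** The average is exact as soon as the number of nodes exceeds the degree,
    and commutes with translations of the argument.  This is what makes
    finite averages reproduce Fourier coefficients. *)
Lemma avg_cosX M m j x c : (m + j < M)%N ->
  avg M (fun t => cos (t - x) ^+ j * cos (m%:R * t + c)) = cos_pow_coef m j * cos (m%:R * x + c).
Proof.
elim: j m c => [|j IH] m c mM.
  rewrite (@eq_avg _ _ (fun t => cos (m%:R * t + c))) => [|t]; last by rewrite mul1r.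
  by rewrite avg_cos ?(leq_ltn_trans _ mM) ?addn0 //=; case: m {mM} => [|m]; rewrite ?mul0r ?add0r.
rewrite (@eq_avg _ _ (fun t => 2^-1 * (cos (t - x) ^+ j * cos (m.+1%:R * t + (c - x)))
   + 2^-1 * (cos (t - x) ^+ j * cos ((if m is m'.+1 then m' else 1%N)%:R * t +
         if m is m'.+1 then c + x else - c - x)))); last first.
  move=> t; rewrite exprSr -mulrA [cos (t - x) * _]cosMcos.
  have -> : m%:R * t + c + (t - x) = m.+1%:R * t + (c - x) by rewrite -natr1; ring.
  have -> : cos (m%:R * t + c - (t - x)) = cos ((if m is m'.+1 then m' else 1%N)%:R * t +
         if m is m'.+1 then c + x else - c - x).
    case: m {mM} => [|m]; last by congr cos; rewrite -natr1; ring.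
    by rewrite -cosN; congr cos; ring.
  by field.
rewrite avgD !avgZ !IH; last 2 first.
- by case: m mM => // m; rewrite addnS addSn => mM; apply: ltnW; apply: ltnW.
- by rewrite addSn -addnS.
have -> : m.+1%:R * x + (c - x) = m%:R * x + c by rewrite -natr1; ring.
have -> : cos ((if m is m'.+1 then m' else 1%N)%:R * x +
         if m is m'.+1 then c + x else - c - x) = cos (m%:R * x + c).
  case: m {mM} => [|m]; last by congr cos; rewrite -natr1; ring.
  by rewrite -cosN; congr cos; ring.
by rewrite /=; field.
Qed.

(** The recursion for the coefficients is Pascal's rule; at frequency zero the
    two neighbours coincide, which matches the symmetry of the central
    binomial coefficients. *)
Lemma cos_pow_coefP j :
  (forall m s, j = (m + s.*2)%N -> cos_pow_coef m j = 'C(j, s)%:R / 2 ^+ j) /\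
  (forall m, (forall s, j <> (m + s.*2)%N) -> cos_pow_coef m j = 0).
Proof.
elim: j => [|j [IH1 IH0]].
  split=> [[|m] [|s] //= _|[|m] h //=]; first by rewrite bin0 divr1.
  by case: (h 0%N).
have e2 : (2 : R) ^+ j != 0 by rewrite expf_neq0.
split=> [[|m] s|[|m] h].
- case: s => // s; rewrite doubleS !add0n => -[js] /=.
  rewrite (IH1 _ s) // binS natrD.
  have -> : 'C(j, s.+1) = 'C(j, s).
    by rewrite -(@bin_sub j s) js -?addnn ?addSn ?leqW ?leq_addr // subSn ?leq_addr // addnK.
  by rewrite exprS; field.
- rewrite addSn => -[js] /=; rewrite (IH1 m s) //.
  case: s js => [|s] js.
    rewrite IH0 => [|s]; first by rewrite !bin0 exprS; field.
    by rewrite js addn0 !addSn => /eqP; rewrite -[X in X == _]addn0 -!addnS eqn_add2l.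
  rewrite (IH1 m.+2 s); last by rewrite js doubleS !addSn !addnS.
  by rewrite binS natrD exprS; field.
- rewrite /= IH0; first by rewrite addr0 mul0r.
  by move=> s js; apply: (h s.+1); rewrite js doubleS !addSn.
- rewrite /= !IH0 ?addr0 ?mul0r // => s js.
    by apply: (h s); rewrite js addSn.
  by apply: (h s.+1); rewrite js doubleS !addSn !addnS.
Qed.

Lemma cos_pow_coefE m s : cos_pow_coef m (m + s.*2) = 'C(m + s.*2, s)%:R / 2 ^+ (m + s.*2).
Proof. exact: (cos_pow_coefP _).1. Qed.

Lemma cos_pow_coef0 m j : (forall s, j <> (m + s.*2)%N) -> cos_pow_coef m j = 0.
Proof. exact: (cos_pow_coefP _).2. Qed.

End Circle.

(** * Fejer means and polynomial approximation *)

Section Fejer.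
Variable R : realType.
Implicit Types (x y t c : R) (f : R -> R) (p Q : {poly R}) (a : nat -> R) (e C : R).

(** Positive frequencies count twice in a cosine series, since they also
    stand for their negatives. *)
Definition cos_weight (m : nat) : R := if m is 0 then 1 else 2.

Lemma cos_weight_ge0 m : 0 <= cos_weight m. Proof. by case: m. Qed.

Definition fejer_sum (L : nat) a x : R :=
  \sum_(m < L) cos_weight m * (1 - m%:R / L%:R) * (a m * cos (m%:R * x)).

Definition fejer (L : nat) y : R := fejer_sum L (fun=> 1) y.

Lemma dirichlet_kernel L y :
  (\sum_(m < L.+1) cos_weight m * cos (m%:R * y)) * (1 - cos y) =
  cos (L%:R * y) - cos (L.+1%:R * y).
Proof.
elim: L => [|L IH].
  by rewrite big_ord_recl big_ord0 /= !mul0r cos0 !mul1r addr0 mul1r.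
rewrite big_ord_recr /= mulrDl IH -(natr1 L.+1) -(natr1 L).
set z := L%:R * y + y.
have -> : (L%:R + 1) * y = z by rewrite /z; ring.
have -> : (L%:R + 1 + 1) * y = z + y by rewrite /z; ring.
have -> : L%:R * y = z - y by rewrite /z; ring.
by move: z => z; rewrite cosB cosD; ring.
Qed.

(** Closed form of the Fejer kernel, kept multiplied by [1 - cos y] so that
    it also holds where this factor vanishes.  It yields both positivity and
    concentration at the origin. *)
Lemma fejerM L y : (0 < L)%N -> fejer L y * (1 - cos y) = (1 - cos (L%:R * y)) / L%:R.
Proof.
move=> L0; have Ln0 : L%:R != 0 :> R by rewrite pnatr_eq0 -lt0n.
suff H n : (\sum_(m < n) cos_weight m * (n%:R - m%:R) * cos (m%:R * y)) * (1 - cos y)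
    = 1 - cos (n%:R * y).
  rewrite -H /fejer /fejer_sum mulrAC; congr (_ * _); rewrite mulr_suml.
  by apply: eq_bigr => m _; field.
elim: n => [|n IH]; first by rewrite big_ord0 !mul0r cos0 subrr.
have -> : \sum_(m < n.+1) cos_weight m * (n.+1%:R - m%:R) * cos (m%:R * y) =
   \sum_(m < n) cos_weight m * (n%:R - m%:R) * cos (m%:R * y) + \sum_(m < n.+1) cos_weight m * cos (m%:R * y).
  rewrite !big_ord_recr /= addrA -big_split /=.
  by congr (_ + _); [apply: eq_bigr => m _|]; rewrite -natr1; ring.
by rewrite mulrDl IH dirichlet_kernel; ring.
Qed.

Lemma fejer_weight_ge0 L (m : 'I_L) : 0 <= 1 - m%:R / L%:R :> R.
Proof.
rewrite subr_ge0 ler_pdivrMr ?mul1r ?ler_nat ?(ltnW (ltn_ord m)) //.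
by rewrite ltr0n (leq_ltn_trans _ (ltn_ord m)).
Qed.

Lemma cos_natM_eq1 y m : cos y = 1 -> cos (m%:R * y) = 1.
Proof.
move=> cy; have sy : sin y = 0 by apply: cos1sin0; rewrite cy normr1.
elim: m => [|m IH]; first by rewrite mul0r cos0.
by rewrite -natr1 mulrDl mul1r cosD IH cy sy mulr0 subr0 mulr1.
Qed.

Lemma fejer_ge0 L y : 0 <= fejer L y.
Proof.
case: L => [|L]; first by rewrite /fejer /fejer_sum big_ord0.
case: (ltgtP (cos y) 1) => [c1|c1|c1].
- have h : 0 < 1 - cos y by rewrite subr_gt0.
  rewrite -(pmulr_lge0 (fejer L.+1 y) h) fejerM //.
- by move: (cos_le1 y); rewrite leNgt c1.
- apply: sumr_ge0 => m _.
  by rewrite (cos_natM_eq1 _ c1) !mulr1 mulr_ge0 ?cos_weight_ge0 ?fejer_weight_ge0.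
Qed.

Lemma avg_fejer M L x : (0 < L <= M)%N -> avg M (fun t => fejer L (x - t)) = 1.
Proof.
move=> /andP[L0 LM]; rewrite /fejer /fejer_sum.
rewrite avg_sum.
case: L L0 LM => // L _ LM; rewrite big_ord_recl /=.
rewrite (@eq_avg _ _ _ (fun=> 1)); last by move=> t; rewrite !mul0r cos0 subr0 !mulr1.
rewrite avg_cst ?(leq_trans _ LM) // big1 ?addr0 // => i _.
rewrite (@eq_avg _ _ _ (fun t => (cos_weight (lift ord0 i) * (1 - (lift ord0 i)%:R / L.+1%:R)) *
   cos ((lift ord0 i)%:R * t + - ((lift ord0 i)%:R * x)))); last first.
  by move=> t; rewrite mul1r -[in LHS]cosN; congr (_ * cos _); ring.
by rewrite avgZ avg_cos ?(leq_trans (ltn_ord _) LM) // mul0r mulr0.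
Qed.

(** The hypothesis is a modulus of continuity stated with the weight
    [1 - cos], because this is exactly the factor which the Fejer kernel
    absorbs at the price 2 / L.  The number [M] of nodes is free, so that one
    bound serves for interpolation and for Fejer means of polynomials. *)
Lemma fejer_approx M L f x e C : (0 < L <= M)%N -> 0 <= C ->
  (forall t, `|f t - f x| <= e + C * (1 - cos (x - t))) ->
  `|avg M (fun t => f t * fejer L (x - t)) - f x| <= e + 2 * C / L%:R.
Proof.
move=> LM C0 H; have /andP[L0 _] := LM.
have -> : avg M (fun t => f t * fejer L (x - t)) - f x =
   avg M (fun t => (f t - f x) * fejer L (x - t)).
  rewrite -[X in _ - X]mulr1 -(avg_fejer x LM) -avgZ -mulN1r -avgZ -avgD.
  by apply: eq_avg => t; ring.
apply: (le_trans (avg_norm _ _)).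
apply: (@le_trans _ _ (avg M (fun t => e * fejer L (x - t) + 2 * C / L%:R * 1))); last first.
  by rewrite avgD !avgZ avg_fejer // avg_cst ?mulr1 //; case/andP: LM => ?; apply: leq_trans.
apply: avg_le => t.
rewrite normrM (ger0_norm (fejer_ge0 _ _)).
apply: (le_trans (ler_wpM2r (fejer_ge0 _ _) (H t))).
have := fejerM (x - t) L0; rewrite mulrC => Eq.
rewrite mulrDl lerD2l -[leLHS]mulrA Eq !mulr1 [2 * C]mulrC -mulrA.
apply: ler_wpM2l => //; apply: ler_wpM2r; first by rewrite invr_ge0.
by move: (cos_geN1 (L%:R * (x - t))); lra.
Qed.

(** The Fourier coefficient of index [m] of [Q.[cos t]], written as a linear
    form in the coefficients of [Q]. *)
Definition fcoef (Q : {poly R}) (m : nat) : R := \sum_(j < size Q) Q`_j * cos_pow_coef R m j.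

Lemma avg_fcoef M m Q x c : (m + size Q < M)%N ->
  avg M (fun t => Q.[cos (t - x)] * cos (m%:R * t + c)) = fcoef Q m * cos (m%:R * x + c).
Proof.
move=> mM; rewrite /fcoef mulr_suml.
rewrite (@eq_avg _ _ _ (fun t => \sum_(j < size Q) Q`_j * (cos (t - x) ^+ j * cos (m%:R * t + c)))).
  rewrite avg_sum; apply: eq_bigr => j _; rewrite avgZ avg_cosX ?mulrA //.
  by rewrite (leq_ltn_trans _ mM) // leq_add2l ltnW.
by move=> t; rewrite horner_coef mulr_suml; apply: eq_bigr => j _; rewrite mulrA.
Qed.

Lemma fcoefE M m Q : (m + size Q < M)%N ->
  fcoef Q m = avg M (fun t => Q.[cos t] * cos (m%:R * t)).
Proof.
move=> mM; have := avg_fcoef 0 0 mM; rewrite mulr0 addr0 cos0 mulr1 => <-.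
by apply: eq_avg => t; rewrite subr0 addr0.
Qed.

Lemma fcoefD Q p m : fcoef (Q + p) m = fcoef Q m + fcoef p m.
Proof.
pose M := (m + maxn (size (Q + p)%R) (maxn (size Q) (size p))).+1.
have h (q : {poly R}) : (size q <= maxn (size (Q + p)%R) (maxn (size Q) (size p)))%N -> (m + size q < M)%N.
  by move=> sq; rewrite ltnS leq_add2l.
rewrite !(@fcoefE M) ?h ?leq_max ?leqnn ?orbT //.
by rewrite -avgD; apply: eq_avg => t; rewrite hornerD mulrDl.
Qed.

Lemma fcoefN Q m : fcoef (- Q) m = - fcoef Q m.
Proof.
rewrite !(@fcoefE (m + size Q).+1) ?size_polyN // -[RHS]mulN1r -avgZ.
by apply: eq_avg => t; rewrite hornerN; ring.
Qed.

Lemma le_fcoef Q m B : (forall t, -1 <= t <= 1 -> `|Q.[t]| <= B) -> `|fcoef Q m| <= B.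
Proof.
move=> H; rewrite (@fcoefE (m + size Q).+1) //.
apply: (le_trans (avg_norm _ _)); rewrite -[leRHS](@avg_cst _ (m + size Q).+1) //.
apply: avg_le => t; rewrite normrM.
apply: (@le_trans _ _ `|Q.[cos t]|); first by rewrite ler_piMr ?cos_max.
by apply: H; rewrite cos_geN1 cos_le1.
Qed.

Lemma avg_fejer_poly M L Q x : (L + size Q < M)%N ->
  avg M (fun t => Q.[cos t] * fejer L (x - t)) = fejer_sum L (fcoef Q) x.
Proof.
move=> LM; rewrite /fejer /fejer_sum.
rewrite (@eq_avg _ _ _ (fun t => \sum_(m < L) (cos_weight m * (1 - m%:R / L%:R)) *
   (Q.[cos t] * cos (m%:R * t - m%:R * x)))); last first.
  move=> t; rewrite mulr_sumr; apply: eq_bigr => m _.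
  by rewrite mul1r -[cos (m%:R * (x - t))]cosN mulrCA; congr (_ * (_ * cos _)); ring.
rewrite avg_sum; apply: eq_bigr => m _; rewrite avgZ; congr (_ * _).
have mM : (m + size Q < M)%N by rewrite (leq_ltn_trans _ LM) // leq_add2r ltnW.
rewrite -[RHS](_ : fcoef Q m * cos (m%:R * 0 + - (m%:R * x)) = _); last first.
  by rewrite mulr0 add0r cosN.
by rewrite -(avg_fcoef _ _ mM); apply: eq_avg => t; rewrite subr0.
Qed.

Lemma chebyshev_poly m : exists T : {poly R}, forall x, T.[cos x] = cos (m%:R * x).
Proof.
suff [] : (exists T : {poly R}, forall x, T.[cos x] = cos (m%:R * x)) /\
  (exists T : {poly R}, forall x, T.[cos x] = cos (m.+1%:R * x)) by [].
elim: m => [|m [[T HT] [T' HT']]].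
  split; first by exists 1 => x; rewrite hornerC mul0r cos0.
  by exists 'X => x; rewrite hornerX mul1r.
split; first by exists T'.
exists (2 *: ('X * T') - T) => x; rewrite hornerD hornerN hornerZ hornerM hornerX HT HT'.
rewrite -(natr1 m.+1) -(natr1 m).
set z := m%:R * x + x.
have -> : (m%:R + 1) * x = z by rewrite /z; ring.
have -> : (m%:R + 1 + 1) * x = z + x by rewrite /z; ring.
have -> : m%:R * x = z - x by rewrite /z; ring.
by move: z => z; rewrite cosB cosD; ring.
Qed.

(** The discrete Fejer mean of an even function, symmetrized, is a
    combination of Chebyshev polynomials in [cos x]. *)
Lemma weierstrass_cos f e C : 0 < e -> 0 <= C -> (forall x, f (- x) = f x) ->
  (forall x t, `|f t - f x| <= e + C * (1 - cos (x - t))) ->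
  exists p : {poly R}, forall x, `|p.[cos x] - f x| <= e + e.
Proof.
move=> e0 C0 fN H.
pose L := (Num.bound (2 * C / e)).+1.
have L0 : (0 < L <= L)%N by rewrite leqnn.
have Lr : (0 : R) < L%:R by rewrite ltr0n.
have LC : 2 * C / L%:R <= e.
  rewrite ler_pdivrMr // -ler_pdivrMl // mulrC.
  apply: (@le_trans _ _ (Num.bound (2 * C / e))%:R); last by rewrite ler_nat.
  apply: ltW; have := archi_boundP (x := 2 * C / e); apply.
  by rewrite divr_ge0 ?mulr_ge0 // ltW.
pose V x := avg L (fun t => f t * fejer L (x - t)).
have HV x : `|V x - f x| <= e + e.
  by apply: (le_trans (fejer_approx L0 C0 (H x))); rewrite lerD2l.
have [T HT] := choice chebyshev_poly.
exists (\sum_(m < L) (cos_weight m * (1 - m%:R / L%:R) * avg L (fun t => f t * cos (m%:R * t))) *: T m) => x.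
(* The average of the means at [x] and [- x] has no sine terms. *)
rewrite horner_sum (_ : \sum_(m < L) _ = (V x + V (- x)) / 2).
  have -> : (V x + V (- x)) / 2 - f x = ((V x - f x) + (V (- x) - f (- x))) / 2.
    by rewrite fN; field.
  rewrite normrM [X in _ * X]ger0_norm ?invr_ge0 // ler_pdivrMr //.
  apply: (le_trans (ler_normD _ _)); have := HV x; have := HV (- x); lra.
rewrite /V -avgD mulrC -avgZ.
transitivity (avg L (fun t => \sum_(m < L) (cos_weight m * (1 - m%:R / L%:R) * cos (m%:R * x)) *
   (f t * cos (m%:R * t)))).
  rewrite avg_sum; apply: eq_bigr => m _.
  by rewrite hornerZ HT avgZ mulrAC.
apply: eq_avg => t.
rewrite -mulrDr mulrCA /fejer /fejer_sum -big_split /= !mulr_sumr.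
apply: eq_bigr => m _.
have -> : m%:R * (- x - t) = - (m%:R * x + m%:R * t) by ring.
have -> : m%:R * (x - t) = m%:R * x - m%:R * t by ring.
by move: (cos_weight m * _) => w; rewrite cosN cosB cosD; field.
Qed.
End Fejer.

(** * Finite averages over the unit sphere of C^(k+1) *)

Section Sphere.
Variable R : realType.
Implicit Types (x y v : seq (R * R)) (f : seq (R * R) -> R) (r t : R).

(** A point of C^n is a list of polar pairs (modulus, argument); this is the
    real inner product of two such points. *)
Fixpoint dot x y : R :=
  match x, y with
  | a :: x', b :: y' => a.1 * b.1 * cos (a.2 - b.2) + dot x' y'
  | _, _ => 0
  end.

Definition normsq x : R := \sum_(a <- x) a.1 ^+ 2.

Definition scale r x := [seq (r * a.1, a.2) | a <- x].

(** The real part of the n-th power of the innermost complex coordinate,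
    which is the last entry of the list: a spherical harmonic of degree [n]. *)
Definition hwv n x : R := (last (0, 0) x).1 ^+ n * cos (n%:R * (last (0, 0) x).2).

Lemma normsq_ge0 x : 0 <= normsq x.
Proof. by apply: sumr_ge0 => a _; apply: sqr_ge0. Qed.

Lemma normsq_cons a x : normsq (a :: x) = a.1 ^+ 2 + normsq x.
Proof. by rewrite /normsq big_cons. Qed.

Lemma normsq_scale r x : normsq (scale r x) = r ^+ 2 * normsq x.
Proof. by rewrite /normsq big_map mulr_sumr; apply: eq_bigr => a _; rewrite exprMn. Qed.

Lemma dot_scale r x y : dot (scale r x) y = r * dot x y.
Proof.
elim: x y => [|a x IH] [|b y] /=; rewrite ?mulr0 //.
by rewrite IH; ring.
Qed.

Lemma hwv_cons n a x : (0 < size x)%N -> hwv n (a :: x) = hwv n x.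
Proof. by case: x. Qed.

Lemma hwv_scale n r x : hwv n (scale r x) = r ^+ n * hwv n x.
Proof.
rewrite /hwv /scale; case: x => [|a x] /=; last first.
  by rewrite (last_map (fun a : R * R => (r * a.1, a.2))) /= exprMn mulrA.
by case: n => [|n]; rewrite ?expr0 ?mul1r // !exprS !mul0r mulr0.
Qed.

Lemma hwv_le1 n x : normsq x <= 1 -> `|hwv n x| <= 1.
Proof.
move=> x1; rewrite /hwv normrM mulr_ile1 ?normr_ge0 ?cos_max // normrX.
apply: exprn_ile1; rewrite ?normr_ge0 // -(@expr_le1 _ 2) ?normr_ge0 // real_normK ?num_real //.
apply: le_trans x1; elim: x => [|a [|b x] IH]; first by rewrite /normsq big_nil expr0n.
  by rewrite normsq_cons lerDl normsq_ge0.
by rewrite normsq_cons (le_trans IH) // lerDr sqr_ge0.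
Qed.

Lemma le_dot x y : `|dot x y| <= (normsq x + normsq y) / 2.
Proof.
elim: x y => [|a x IH] [|b y] /=; rewrite ?normr0 ?divr_ge0 ?addr_ge0 ?normsq_ge0 //.
rewrite !normsq_cons; apply: (le_trans (ler_normD _ _)).
have h : `|a.1 * b.1 * cos (a.2 - b.2)| <= (a.1 ^+ 2 + b.1 ^+ 2) / 2.
  rewrite normrM (@le_trans _ _ `|a.1 * b.1|) // ?ler_piMr ?normr_ge0 ?cos_max //.
  rewrite ler_norml; have := sqr_ge0 (a.1 + b.1); have := sqr_ge0 (a.1 - b.1).
  by rewrite sqrrB sqrrD => h1 h2; apply/andP; split; lra.
by have := IH y; lra.
Qed.

(** A discretization, up to a constant factor, of the uniform measure on
    the unit sphere of C^(k+1).  The new coordinate has modulus [sqrt p] and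
    a uniform argument, the others are shrunk by [sqrt (1 - p)], and [p] has
    density proportional to [(1 - p) ^+ (k - 1)] on [0, 1]. *)
Fixpoint sphere_avg k M (f : seq (R * R) -> R) : R :=
  match k with
  | 0 => avg M (fun t => f [:: (1, t)])
  | k'.+1 => M%:R^-1 * \sum_(i < M) (1 - i%:R / M%:R) ^+ k' *
      avg M (fun t => sphere_avg k' M (fun x =>
        f ((Num.sqrt (i%:R / M%:R), t) :: scale (Num.sqrt (1 - i%:R / M%:R)) x)))
  end.

Definition on_sphere k x := size x = k.+1 /\ normsq x = 1.

Lemma frac_le1 M (i : 'I_M) : i%:R / M%:R <= 1 :> R.
Proof.
rewrite ler_pdivrMr ?mul1r ?ler_nat ?(ltnW (ltn_ord i)) //.
by rewrite ltr0n (leq_ltn_trans _ (ltn_ord i)).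
Qed.

(** The average is a finite positive combination of values at points of the
    sphere; this is the form in which positive definiteness applies. *)
Lemma sphere_avg_design k M : exists s : seq (R * seq (R * R)),
  [/\ forall f, sphere_avg k M f = \sum_(p <- s) p.1 * f p.2,
     forall p, p \in s -> 0 <= p.1 & forall p, p \in s -> on_sphere k p.2].
Proof.
elim: k => [|k [s [IHf IH0 IHs]]].
  exists [seq (M%:R^-1, [:: (1, pi *+ 2 * (i : 'I_M)%:R / M%:R)]) | i <- enum 'I_M]; split.
  - move=> f; rewrite big_map big_enum /= /avg mulr_sumr.
    by apply: eq_bigr.
  - by move=> p /mapP[i _ ->] /=; rewrite invr_ge0.
  - by move=> p /mapP[i _ ->] /=; split=> //; rewrite /normsq big_seq1 expr1n.
pose P (it : 'I_M * 'I_M) := [seq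
   (M%:R^-1 * (1 - it.1%:R / M%:R) ^+ k * M%:R^-1 * p.1,
    (Num.sqrt (it.1%:R / M%:R), pi *+ 2 * it.2%:R / M%:R)
      :: scale (Num.sqrt (1 - it.1%:R / M%:R)) p.2) | p <- s].
have H p : p \in flatten [seq P it | it <- enum {: 'I_M * 'I_M}] ->
    exists it : 'I_M * 'I_M, exists2 q, q \in s &
   p = (M%:R^-1 * (1 - it.1%:R / M%:R) ^+ k * M%:R^-1 * q.1,
    (Num.sqrt (it.1%:R / M%:R), pi *+ 2 * it.2%:R / M%:R)
      :: scale (Num.sqrt (1 - it.1%:R / M%:R)) q.2).
  by move=> /flatten_mapP[it _ /mapP[q qs ->]]; exists it, q.
exists (flatten [seq P it | it <- enum {: 'I_M * 'I_M}]); split.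
- move=> f /=; rewrite big_flatten big_map big_enum /=.
  rewrite -(pair_bigA _ (fun i u : 'I_M => \sum_(p <- P (i, u)) p.1 * f p.2)) /=.
  rewrite mulr_sumr; apply: eq_bigr => i _.
  rewrite /avg !mulr_sumr; apply: eq_bigr => u _.
  rewrite IHf big_map !mulr_sumr /=; apply: eq_bigr => q _.
  by ring.
- move=> p /H[it [q qs ->]] /=.
  by rewrite !mulr_ge0 ?invr_ge0 ?exprn_ge0 ?subr_ge0 ?frac_le1 ?IH0.
- move=> p /H[it [q qs ->]] /=; have [sq nq] := IHs _ qs; split.
    by rewrite /= size_map sq.
  rewrite normsq_cons normsq_scale /= nq !sqr_sqrtr ?subr_ge0 ?frac_le1 ?divr_ge0 //.
  by ring.
Qed.

Lemma sphere_avg_sum k M (I : Type) (r : seq I) (P : pred I) F :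
  sphere_avg k M (fun x => \sum_(i <- r | P i) F i x) = \sum_(i <- r | P i) sphere_avg k M (F i).
Proof.
have [s [E _ _]] := sphere_avg_design k M; rewrite E (eq_bigr _ (fun i _ => E _)).
by rewrite exchange_big; apply: eq_bigr => p _; rewrite mulr_sumr.
Qed.

Lemma sphere_avgZ k M c f : sphere_avg k M (fun x => c * f x) = c * sphere_avg k M f.
Proof.
have [s [E _ _]] := sphere_avg_design k M; rewrite !E mulr_sumr.
by apply: eq_bigr => p _; rewrite mulrCA.
Qed.

Lemma le_sphere_avg k M f g : (forall x, on_sphere k x -> f x <= g x) -> sphere_avg k M f <= sphere_avg k M g.
Proof.
have [s [E h0 hs]] := sphere_avg_design k M => H; rewrite !E !big_seq.
by apply: ler_sum => p ps; rewrite ler_wpM2l ?h0 // H //; apply: hs.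
Qed.

Lemma eq_sphere_avg k M f g : (forall x, on_sphere k x -> f x = g x) -> sphere_avg k M f = sphere_avg k M g.
Proof. by move=> H; apply/le_anti/andP; split; apply: le_sphere_avg => x /H ->. Qed.

Lemma sphere_avg1 k M : 0 <= sphere_avg k M (fun=> 1) <= 1.
Proof.
apply/andP; split.
  have [s [E h0 _]] := sphere_avg_design k M; rewrite E big_seq.
  by apply: sumr_ge0 => p ps; rewrite mulr1 h0.
case: M => [|M]; first by case: k => [|k] /=; rewrite /avg invr0 mul0r.
elim: k => [|k IH] /=; first by rewrite avg_cst.
rewrite ler_pdivrMl ?ltr0n // mulr1.
rewrite [leRHS](_ : _ = \sum_(i < M.+1) 1); last by rewrite sumr_const card_ord.
apply: ler_sum => i _.
rewrite avg_cst // mulr_ile1 ?exprn_ge0 ?subr_ge0 ?frac_le1 //.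
- have [s [E h0 _]] := sphere_avg_design k M.+1; rewrite E big_seq.
  by apply: sumr_ge0 => p ps; rewrite mulr1 h0.
- by rewrite exprn_ile1 ?subr_ge0 ?frac_le1 // lerBlDr lerDl divr_ge0.
Qed.

(** A Riemann sum for the Beta integral with exponents [a] and [b]. *)
Definition beta_sum M a b : R :=
  M%:R^-1 * \sum_(i < M) (1 - i%:R / M%:R) ^+ a * (i%:R / M%:R) ^+ b.

Lemma subXX_bounds (x y : R) b : 0 <= y <= x ->
  b.+1%:R * y ^+ b * (x - y) <= x ^+ b.+1 - y ^+ b.+1 <= b.+1%:R * x ^+ b * (x - y).
Proof.
move=> /andP[y0 yx]; have x0 := le_trans y0 yx.
rewrite subrXX !(mulrC (x - y)) /=.
have H (c : R) : b.+1%:R * c = \sum_(i < b.+1) c by rewrite sumr_const card_ord mulr_natl.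
apply/andP; split; apply: ler_wpM2r; rewrite ?subr_ge0 // H; apply: ler_sum => i _.
  have -> : y ^+ b = y ^+ (b - i) * y ^+ i by rewrite -exprD subnK // -ltnS.
  by rewrite ler_wpM2r ?exprn_ge0 // lerXn2r.
have -> : x ^+ b = x ^+ (b - i) * x ^+ i by rewrite -exprD subnK // -ltnS.
by rewrite ler_wpM2l ?exprn_ge0 // lerXn2r.
Qed.

Lemma riemann_pow M b : (0 < M)%N ->
  M%:R^-1 * \sum_(i < M) (i%:R / M%:R) ^+ b <= b.+1%:R^-1 :> R /\
  b.+1%:R^-1 <= M%:R^-1 * \sum_(i < M) (i.+1%:R / M%:R) ^+ b :> R.
Proof.
move=> M0; have Mn0 : M%:R != 0 :> R by rewrite pnatr_eq0 -lt0n.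
pose F i : R := (i%:R / M%:R) ^+ b.+1.
have -> : b.+1%:R^-1 = b.+1%:R^-1 * \sum_(i < M) (F i.+1 - F i).
  rewrite -(big_mkord xpredT (fun i => F i.+1 - F i)) telescope_sumr // /F.
  by rewrite divff // expr1n mul0r expr0n subr0 mulr1.
have E (i : nat) : i.+1%:R / M%:R - i%:R / M%:R = M%:R^-1 :> R by rewrite -natr1; field.
have H (i : 'I_M) : 0 <= (i%:R / M%:R : R) <= i.+1%:R / M%:R.
  by rewrite divr_ge0 //= ler_pM2r ?invr_gt0 ?ltr0n // ler_nat.
have L := subXX_bounds b (H _).
rewrite !mulr_sumr; split; apply: ler_sum => i _; have /andP[h1 h2] := L i; rewrite E in h1 h2.
  by rewrite ler_pdivlMl ?ltr0n //; apply: le_trans h1; rewrite -mulrA [_ ^+ b * _]mulrC.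
by rewrite ler_pdivrMl ?ltr0n //; apply: le_trans h2 _; rewrite -mulrA [_ ^+ b * _]mulrC.
Qed.

(** The recursion on [a] holds for the Riemann sums as well as for the
    limits, so only [a = 0] needs an estimate. *)
Lemma beta_sum_lim M a b : (0 < M)%N ->
  `|beta_sum M a b - a`!%:R * b`!%:R / (a + b).+1`!%:R| <= 2 ^+ a / M%:R.
Proof.
move=> M0; have Mn0 : M%:R != 0 :> R by rewrite pnatr_eq0 -lt0n.
elim: a b => [|a IH] b.
  have -> : beta_sum M 0 b = M%:R^-1 * \sum_(i < M) (i%:R / M%:R) ^+ b.
    by rewrite /beta_sum; congr (_ * _); apply: eq_bigr => i _; rewrite mul1r.
  have -> : 0`!%:R * b`!%:R / (0 + b).+1`!%:R = b.+1%:R^-1 :> R.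
    have f0 : b`!%:R != 0 :> R by rewrite pnatr_eq0 -lt0n fact_gt0.
    by rewrite add0n factS natrM mul1r invfM mulrCA mulfV // mulr1.
  have [h1 h2] := riemann_pow b M0.
  rewrite distrC ger0_norm ?subr_ge0 // expr0 mul1r.
  rewrite lerBlDl; apply: (le_trans h2).
  rewrite -[X in _ <= _ + X]mulr1 -mulrDr; apply: ler_wpM2l; first by rewrite invr_ge0.
  case: M M0 {Mn0 h1 h2} => // M _.
  rewrite big_ord_recr big_ord_recl /= divff ?pnatr_eq0 // expr1n lerD2r lerDr.
  by rewrite exprn_ge0 // mul0r.
have -> : beta_sum M a.+1 b = beta_sum M a b - beta_sum M a b.+1.
  rewrite /beta_sum -mulrBr -sumrB; congr (_ * _); apply: eq_bigr => i _.
  by rewrite !exprS; ring.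
have -> : a.+1`!%:R * b`!%:R / (a.+1 + b).+1`!%:R =
  a`!%:R * b`!%:R / (a + b).+1`!%:R - a`!%:R * b.+1`!%:R / (a + b.+1).+1`!%:R :> R.
  have f0 : (a + b).+1`!%:R != 0 :> R by rewrite pnatr_eq0 -lt0n fact_gt0.
  have n0 : (a + b).+2%:R != 0 :> R by rewrite pnatr_eq0.
  have fS m : m.+1`!%:R = m.+1%:R * m`!%:R :> R by rewrite factS natrM.
  rewrite addSn addnS (fS (a + b).+1) (fS a) (fS b).
  have -> : (a.+1%:R : R) = (a + b).+2%:R - b.+1%:R.
    by rewrite -natrB ?ltnS ?leqW ?leq_addl // subSS -addSn addnK.
  move: ((a + b).+1`!%:R) f0 ((a + b).+2%:R) n0 (a`!%:R) (b`!%:R) (b.+1%:R) => u u0 w w0 fa fb b1.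
  by field; rewrite u0 w0.
have h4 (u w z t : R) : u - w - (z - t) = (u - z) - (w - t) by ring.
rewrite h4.
apply: (le_trans (ler_normB _ _)).
have h : (2 : R) ^+ a.+1 / M%:R = 2 ^+ a / M%:R + 2 ^+ a / M%:R by rewrite exprS; ring.
by rewrite h lerD.
Qed.

End Sphere.

(** * The Funk-Hecke formula on highest weight vectors *)

Section FunkHecke.
Variable R : realType.
Implicit Types (x y v : seq (R * R)) (f : seq (R * R) -> R) (r t : R).

(** Divided powers turn the binomial formula into a plain convolution. *)
Definition divpow (j : nat) (t : R) : R := t ^+ j / j`!%:R.

Lemma fact_neq0 j : j`!%:R != 0 :> R.
Proof. by rewrite pnatr_eq0 -lt0n fact_gt0. Qed.

Lemma bin_div_fact (j i : nat) : (i <= j)%N ->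
  'C(j, i)%:R / j`!%:R = (i`!%:R)^-1 * ((j - i)`!%:R)^-1 :> R.
Proof.
move=> ij; rewrite -(bin_fact ij) !natrM.
rewrite invfM mulrA mulfV ?mul1r ?invfM //.
by rewrite pnatr_eq0 -lt0n bin_gt0.
Qed.

Lemma divpowD j (a b : R) : divpow j (a + b) = \sum_(i < j.+1) divpow (j - i) a * divpow i b.
Proof.
rewrite /divpow exprDn mulr_suml; apply: eq_bigr => i _.
transitivity (a ^+ (j - i) * b ^+ i * ('C(j, i)%:R / j`!%:R)).
  by rewrite -[_ *+ _]mulr_natr; ring.
by rewrite bin_div_fact; [ring | rewrite -ltnS].
Qed.

Lemma divpowM j (a b : R) : divpow j (a * b) = a ^+ j * divpow j b.
Proof. by rewrite /divpow exprMn mulrA. Qed.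

(** The factor contributed by the modulus of the new coordinate when its
    part in the divided power has degree [j - i]. *)
Definition step_weight M k n (j i : nat) : R := M%:R^-1 * \sum_(l < M)
  (1 - l%:R / M%:R) ^+ k * (Num.sqrt (l%:R / M%:R) ^+ (j - i)
    * Num.sqrt (1 - l%:R / M%:R) ^+ (i + n)).

(** The inner product splits as (new coordinate) + (old coordinates).  Expand
    the divided power of this sum; the average over the new argument is exact
    and leaves a Fourier coefficient of a power of the cosine at frequency
    zero. *)
Lemma sphere_avgS k M n j (r b : R) v : (j < M)%N ->
  sphere_avg k.+1 M (fun x => divpow j (dot x ((r, b) :: v)) * hwv n x) =
  \sum_(i < j.+1) step_weight M k n j i * (r ^+ (j - i) * cos_pow_coef R 0 (j - i) / (j - i)`!%:R)
     * sphere_avg k M (fun x => divpow i (dot x v) * hwv n x).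
Proof.
move=> jM /=.
pose Y (i : nat) := sphere_avg k M (fun x => divpow i (dot x v) * hwv n x).
transitivity (M%:R^-1 * \sum_(l < M) \sum_(i < j.+1)
   ((1 - l%:R / M%:R) ^+ k * (Num.sqrt (l%:R / M%:R) ^+ (j - i) * Num.sqrt (1 - l%:R / M%:R) ^+ (i + n)))
   * (r ^+ (j - i) * cos_pow_coef R 0 (j - i) / (j - i)`!%:R * Y i)); last first.
  rewrite exchange_big mulr_sumr; apply: eq_bigr => i _.
  rewrite -/(Y i) -mulr_suml /step_weight; ring.
congr (_ * _); apply: eq_bigr => l _.
set p := Num.sqrt _; set q := Num.sqrt _.
transitivity ((1 - l%:R / M%:R) ^+ k * avg M (fun t => \sum_(i < j.+1)
   (p ^+ (j - i) * q ^+ (i + n) * (r ^+ (j - i) / (j - i)`!%:R * Y i)) *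
      (cos (t - b) ^+ (j - i) * cos (0%:R * t + 0)))); last first.
  rewrite avg_sum mulr_sumr; apply: eq_bigr => i _.
  rewrite avgZ (@avg_cosX R M 0%N); last by rewrite add0n (leq_ltn_trans _ jM) // leq_subr.
  by rewrite mul0r addr0 cos0; ring.
congr (_ * _); apply: eq_avg => t.
transitivity (sphere_avg k M (fun x => \sum_(i < j.+1) (p ^+ (j - i) * q ^+ (i + n) *
   (r ^+ (j - i) / (j - i)`!%:R) * cos (t - b) ^+ (j - i)) * (divpow i (dot x v) * hwv n x))).
  apply: eq_sphere_avg => x [sx _].
  rewrite hwv_cons ?hwv_scale ?size_map ?sx //.
  have -> : p * r * cos (t - b) + dot (scale q x) v = p * (r * cos (t - b)) + q * dot x v.
    by rewrite dot_scale mulrA.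
  rewrite divpowD mulr_suml; apply: eq_bigr => i _; rewrite !divpowM exprD /divpow; ring.
rewrite sphere_avg_sum; apply: eq_bigr => i _.
by rewrite sphere_avgZ mul0r addr0 cos0 /Y; ring.
Qed.

Lemma step_weight_le M k n j i : 0 <= step_weight M k n j i <= 1.
Proof.
have H (l : 'I_M) : (0 : R) <= (1 - l%:R / M%:R) ^+ k * (Num.sqrt (l%:R / M%:R) ^+ (j - i)
    * Num.sqrt (1 - l%:R / M%:R) ^+ (i + n)) <= (1 : R).
  have h0 : 0 <= l%:R / M%:R :> R by rewrite divr_ge0.
  have h1 := frac_le1 R l.
  have h2 : 0 <= 1 - l%:R / M%:R :> R by rewrite subr_ge0.
  have h3 : 1 - l%:R / M%:R <= 1 :> R by rewrite lerBlDr lerDl.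
  have s1 (p : R) : 0 <= p -> p <= 1 -> Num.sqrt p <= 1.
    by move=> p0 p1; rewrite -[leRHS]sqrtr1 ler_wsqrtr.
  apply/andP; split; first by rewrite !mulr_ge0 ?exprn_ge0 ?sqrtr_ge0 //.
  apply: mulr_ile1; rewrite ?mulr_ge0 ?exprn_ge0 ?exprn_ile1 ?sqrtr_ge0 //.
  by apply: mulr_ile1; rewrite ?exprn_ge0 ?sqrtr_ge0 // exprn_ile1 ?sqrtr_ge0 ?s1.
rewrite /step_weight; apply/andP; split.
  by rewrite mulr_ge0 ?invr_ge0 // sumr_ge0 // => l _; case/andP: (H l).
case: M H => [|M] H; first by rewrite invr0 mul0r.
rewrite ler_pdivrMl ?ltr0n // mulr1 [leRHS](_ : _ = \sum_(l < M.+1) 1).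
  by apply: ler_sum => l _; case/andP: (H l).
by rewrite sumr_const card_ord.
Qed.

(** Only even exponents matter, and for them the square roots disappear and
    a Beta sum remains. *)
Lemma step_weight_lim M k n s b : (0 < M)%N ->
  `|step_weight M k n (n + s.*2 + b.*2) (n + s.*2) -
    (k + (s + n))`!%:R * b`!%:R / (k + (s + n) + b).+1`!%:R| <= 2 ^+ (k + (s + n)) / M%:R.
Proof.
move=> M0; suff -> : step_weight M k n (n + s.*2 + b.*2) (n + s.*2) = beta_sum R M (k + (s + n)) b.
  exact: beta_sum_lim.
rewrite /beta_sum /step_weight; congr (_ * _); apply: eq_bigr => l _; rewrite addKn.
have -> : (n + s.*2 + n = 2 * (s + n))%N by lia.
rewrite -mul2n !exprM !sqr_sqrtr ?subr_ge0 ?frac_le1 ?divr_ge0 //.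
by rewrite !exprD; ring.
Qed.

(** The multiplier of the divided power of degree [j] on harmonics of degree
    [n].  In this form it is visibly [2 ^+ k] times a Fourier coefficient, of
    index [n + k], of the k-fold primitive of that divided power. *)
Definition fh_eigen k n j : R := 2 ^+ k * cos_pow_coef R (n + k) (j + k) / (j + k)`!%:R.

Lemma fh_eigenE k n s : fh_eigen k n (n + s.*2) =
  (2 ^+ (n + s.*2))^-1 * (s`!%:R)^-1 * ((s + n + k)`!%:R)^-1.
Proof.
rewrite /fh_eigen addnAC cos_pow_coefE -addnAC.
have -> : 2 ^+ k * ('C(n + s.*2 + k, s)%:R / 2 ^+ (n + s.*2 + k)) / (n + s.*2 + k)`!%:R
  = (2 ^+ k / 2 ^+ (n + s.*2 + k)) * ('C(n + s.*2 + k, s)%:R / (n + s.*2 + k)`!%:R) :> R by ring.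
rewrite bin_div_fact; last by lia.
have -> : (n + s.*2 + k - s = s + n + k)%N by lia.
have -> : 2 ^+ k / 2 ^+ (n + s.*2 + k) = (2 ^+ (n + s.*2))^-1 :> R.
  by rewrite exprD invfM mulrCA mulfV ?expf_neq0 // mulr1.
by rewrite mulrA.
Qed.

Lemma fh_eigen0 k n j : (forall s, j <> (n + s.*2)%N) -> fh_eigen k n j = 0.
Proof.
move=> h; rewrite /fh_eigen cos_pow_coef0 ?mulr0 ?mul0r // => s; rewrite addnAC => /eqP.
by rewrite eqn_add2r => /eqP; exact: h.
Qed.

Lemma sum_parity_supp n s (F : nat -> R) :
  (forall i, (forall s', i <> (n + s'.*2)%N) -> F i = 0) ->
  \sum_(i < (n + s.*2).+1) F i = \sum_(i < s.+1) F (n + i.*2)%N.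
Proof.
move=> H; elim: s => [|s IH].
  rewrite addn0 big_ord_recr big_ord1 /= addn0 big1 ?add0r // => i _.
  by apply: H => s' E; have := ltn_ord i; rewrite E ltnNge leq_addr.
rewrite doubleS !addnS big_ord_recr big_ord_recr IH /= [RHS]big_ord_recr /=.
rewrite (H (n + s.*2).+1) ?addr0 ?doubleS ?addnS // => s' /eqP.
rewrite -addnS eqn_add2l => /eqP /(congr1 odd) /=.
by rewrite !odd_double.
Qed.

(** The passage from [k] to [k + 1] complex coordinates for the exact
    multipliers: after cancelling factorials it is the binomial expansion of
    [(r ^+ 2 + N) ^+ s]. *)
Lemma fh_eigen_rec k n s (r N : R) :
  \sum_(i < (n + s.*2).+1)
    ((k + ((i - n)./2 + n))`!%:R * ((n + s.*2 - i)./2)`!%:R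
       / (k + ((i - n)./2 + n) + (n + s.*2 - i)./2).+1`!%:R
     * (r ^+ (n + s.*2 - i) * cos_pow_coef R 0 (n + s.*2 - i) / (n + s.*2 - i)`!%:R)
     * (fh_eigen k n i * N ^+ (i - n)./2))
  = fh_eigen k.+1 n (n + s.*2) * (r ^+ 2 + N) ^+ s.
Proof.
pose F i := ((k + ((i - n)./2 + n))`!%:R * ((n + s.*2 - i)./2)`!%:R
       / (k + ((i - n)./2 + n) + (n + s.*2 - i)./2).+1`!%:R
     * (r ^+ (n + s.*2 - i) * cos_pow_coef R 0 (n + s.*2 - i) / (n + s.*2 - i)`!%:R)
     * (fh_eigen k n i * N ^+ (i - n)./2)).
rewrite (@sum_parity_supp n s F) => [|i h]; last by rewrite /F fh_eigen0 // mul0r mulr0.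
rewrite exprDn mulr_sumr; apply: eq_bigr => i _; rewrite /F.
have is_ : (i <= s)%N by rewrite -ltnS.
move: (nat_of_ord i) is_ => {}i is_.
have [b ->] : exists b, s = (i + b)%N by exists (s - i)%N; rewrite subnKC.
have -> : (n + i.*2 - n = i.*2)%N by lia.
have -> : (n + (i + b).*2 - (n + i.*2) = b.*2)%N by lia.
have -> : (i + b - i = b)%N by lia.
rewrite !doubleK !fh_eigenE.
have -> : cos_pow_coef R 0 b.*2 = 'C(b.*2, b)%:R / 2 ^+ b.*2 by have := cos_pow_coefE R 0 b; rewrite add0n.
have -> : (k + (i + n) + b).+1 = (i + b + n + k.+1)%N by lia.
have -> : (i + n + k = k + (i + n))%N by lia.
have -> : (n + (i + b).*2 = (n + i.*2) + b.*2)%N by lia.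
have E1 : 'C(b.*2, b)%:R / b.*2`!%:R = (b`!%:R)^-1 * (b`!%:R)^-1 :> R.
  by rewrite bin_div_fact; [congr (_ * (_`!%:R)^-1); lia | lia].
have E2 : 'C(i + b, i)%:R / (i + b)`!%:R = (i`!%:R)^-1 * (b`!%:R)^-1 :> R.
  by rewrite bin_div_fact ?addKn ?leq_addr.
transitivity ((k + (i + n))`!%:R * b`!%:R / (i + b + n + k.+1)`!%:R *
   (r ^+ b.*2 * (2 ^+ b.*2)^-1 * ('C(b.*2, b)%:R / b.*2`!%:R)) *
   (((2 ^+ (n + i.*2))^-1 * i`!%:R^-1 * (k + (i + n))`!%:R^-1) * N ^+ i)); first by ring.
rewrite E1.
transitivity ((2 ^+ (n + i.*2 + b.*2))^-1 * ((i + b + n + k.+1)`!%:R)^-1 *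
   ((r ^+ 2) ^+ b * N ^+ i) * ('C(i + b, i)%:R / (i + b)`!%:R)); last first.
  by rewrite -[_ *+ 'C(_, _)]mulr_natr; ring.
rewrite E2 (exprD 2 (n + i.*2) b.*2) invfM -exprM mul2n.
have := fact_neq0 b; have := fact_neq0 (k + (i + n)).
move: (_`!%:R) => u; move: (b`!%:R) => w u0 w0.
move: (2 ^+ _)^-1 (2 ^+ _)^-1 (i`!%:R^-1) (_`!%:R^-1) => c2 c3 c4 c5.
by field; rewrite u0 w0.
Qed.
End FunkHecke.

Section FunkHeckeLimit.
Variable R : realType.
Implicit Types (x y v : seq (R * R)) (f : seq (R * R) -> R) (r t : R).

Definition beta_value k n j i : R :=
  (k + ((i - n)./2 + n))`!%:R * ((j - i)./2)`!%:R / (k + ((i - n)./2 + n) + (j - i)./2).+1`!%:R.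

Lemma norm_prod_diff_le (S Y B Z e1 e2 c d M : R) : 0 <= S <= 1 -> `|Y - Z| <= e1 / M ->
  `|S - B| <= e2 / M -> `|Z| <= c -> `|d| <= 1 -> 0 <= M ->
  `|S * d * Y - B * d * Z| <= (e1 + c * e2) / M.
Proof.
move=> /andP[S0 S1] H1 H2 Hc d1 M0.
have -> : S * d * Y - B * d * Z = d * (S * (Y - Z) + Z * (S - B)) by ring.
rewrite normrM; apply: (@le_trans _ _ `|S * (Y - Z) + Z * (S - B)|).
  by rewrite ler_piMl.
apply: (le_trans (ler_normD _ _)); rewrite mulrDl !normrM (ger0_norm S0) -mulrA lerD //.
  by apply: le_trans H1; rewrite ler_piMl.
by rewrite ler_pM.
Qed.

(** The Funk-Hecke identity for divided powers with error [C / M], uniformly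
    for [v] in the unit ball.  The point [v] need not lie on the sphere, for
    the induction on [k] applies the identity to a truncation of [v]. *)
Definition funk_hecke_rate k n i (C : R) := forall M v, (n + i < M)%N -> size v = k.+1 -> normsq v <= 1 ->
    `|sphere_avg k M (fun x => divpow i (dot x v) * hwv n x)
        - fh_eigen R k n i * normsq v ^+ (i - n)./2 * hwv n v| <= C / M%:R.

Lemma cos_pow_coef_itv m j : 0 <= cos_pow_coef R m j <= 1.
Proof.
elim: j m => [|j IH] m /=; first by case: (m == 0)%N; rewrite lexx ler01.
have := IH m.+1; have := IH (match m with 0 => 1 | m'.+1 => m' end)%N.
move=> /andP[? ?] /andP[? ?]; apply/andP; split; lra.
Qed.

Lemma cos_pow_coef_fact_le1 m j : `|cos_pow_coef R m j / j`!%:R| <= 1.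
Proof.
have /andP[a0 a1] := cos_pow_coef_itv m j.
rewrite ger0_norm ?divr_ge0 // ler_pdivrMr ?ltr0n ?fact_gt0 // mul1r.
by rewrite (le_trans a1) // ler1n fact_gt0.
Qed.

(** In the expansion over degrees, a term either vanishes by parity, or tends
    to zero because the multiplier does, or has an explicit Beta limit. *)
Lemma funk_hecke_term k n j i C0 : (i <= j)%N -> 0 <= C0 -> funk_hecke_rate k n i C0 -> exists2 C, 0 <= C &
  forall M (r : R) v, (n + j < M)%N -> size v = k.+1 -> normsq v <= 1 -> `|r| <= 1 ->
    `|step_weight R M k n j i * (r ^+ (j - i) * cos_pow_coef R 0 (j - i) / (j - i)`!%:R)
       * sphere_avg k M (fun x => divpow i (dot x v) * hwv n x)
     - beta_value k n j i * (r ^+ (j - i) * cos_pow_coef R 0 (j - i) / (j - i)`!%:R)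
       * (fh_eigen R k n i * normsq v ^+ (i - n)./2 * hwv n v)| <= C / M%:R.
Proof.
move=> ij C00 HC0.
have Hd (r : R) : `|r| <= 1 -> `|r ^+ (j - i) * cos_pow_coef R 0 (j - i) / (j - i)`!%:R| <= 1.
  move=> r1; rewrite -mulrA normrM mulr_ile1 ?cos_pow_coef_fact_le1 //.
  by rewrite normrX exprn_ile1.
have Mi M : (n + j < M)%N -> (n + i < M)%N by lia.
have [[b jb]|nb] := pselect (exists b, (j - i)%N = b.*2); last first.
  exists 0 => // M r v _ _ _ _; rewrite cos_pow_coef0 => [|s e]; last by apply: nb; exists s.
  by rewrite !(mulr0, mul0r) subrr normr0.
have [[s is_]|ns] := pselect (exists s, i = (n + s.*2)%N); last first.
  exists C0 => // M r v nM sv v1 r1.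
  have := HC0 M v (Mi _ nM) sv v1; rewrite fh_eigen0 => [|s e]; last by apply: ns; exists s.
  rewrite !(mulr0, mul0r) !subr0 => Y; apply: le_trans Y.
  rewrite normrM ler_piMl // normrM mulr_ile1 ?Hd //.
  by have /andP[h0 h1] := step_weight_le R M k n j i; rewrite ger0_norm.
exists (C0 + `|fh_eigen R k n i| * 2 ^+ (k + (s + n))).
  by rewrite addr_ge0 // mulr_ge0 // exprn_ge0.
move=> M r v nM sv v1 r1.
apply: norm_prod_diff_le; rewrite ?Hd ?step_weight_le //; first exact: HC0 (Mi _ nM) sv v1.
- have -> : j = (n + s.*2 + b.*2)%N by lia.
  rewrite is_ /beta_value.
  have -> : (n + s.*2 - n = s.*2)%N by lia.
  have -> : (n + s.*2 + b.*2 - (n + s.*2) = b.*2)%N by lia.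
  rewrite !doubleK; apply: step_weight_lim; lia.
- rewrite -mulrA normrM ler_piMr // normrM mulr_ile1 ?hwv_le1 //.
  by rewrite normrX exprn_ile1 // ger0_norm ?normsq_ge0.
Qed.

(** Both sides are sums over the degree carried by the old coordinates, the
    right one by [fh_eigen_rec]; compare them term by term. *)
Lemma funk_hecke_step k n : (forall j, exists2 C, 0 <= C & funk_hecke_rate k n j C) ->
  forall j, exists2 C, 0 <= C & funk_hecke_rate k.+1 n j C.
Proof.
move=> IH j.
have : forall i, exists C, (i <= j)%N -> 0 <= C /\
  forall M (r : R) v, (n + j < M)%N -> size v = k.+1 -> normsq v <= 1 -> `|r| <= 1 ->
    `|step_weight R M k n j i * (r ^+ (j - i) * cos_pow_coef R 0 (j - i) / (j - i)`!%:R)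
       * sphere_avg k M (fun x => divpow i (dot x v) * hwv n x)
     - beta_value k n j i * (r ^+ (j - i) * cos_pow_coef R 0 (j - i) / (j - i)`!%:R)
       * (fh_eigen R k n i * normsq v ^+ (i - n)./2 * hwv n v)| <= C / M%:R.
  move=> i; case: (boolP (i <= j)%N) => ij; last by exists 0.
  have [C0 C00 HC0] := IH i; have [C Cp HC] := funk_hecke_term ij C00 HC0.
  by exists C.
move=> /choice[C HC].
exists (\sum_(i < j.+1) C i).
  apply: sumr_ge0 => i _; have ij : (i <= j)%N by rewrite -ltnS.
  by case: (HC i ij).
move=> M [|[r b] v] // nM [sv]; rewrite normsq_cons -[(r, b).1]/r => v1.
have r1 : `|r| <= 1.
  rewrite -(@expr_le1 _ 2) // real_normK ?num_real //.
  by apply: le_trans v1; rewrite lerDl normsq_ge0.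
have N1 : normsq v <= 1 by apply: le_trans v1; rewrite lerDr sqr_ge0.
rewrite sphere_avgS; last by lia.
rewrite hwv_cons ?sv //.
have -> : fh_eigen R k.+1 n j * (r ^+ 2 + normsq v) ^+ (j - n)./2 * hwv n v =
  \sum_(i < j.+1) beta_value k n j i * (r ^+ (j - i) * cos_pow_coef R 0 (j - i) / (j - i)`!%:R)
       * (fh_eigen R k n i * normsq v ^+ (i - n)./2 * hwv n v).
  have [[s js]|ns] := pselect (exists s, j = (n + s.*2)%N).
    rewrite js; have -> : (n + s.*2 - n = s.*2)%N by lia.
    rewrite doubleK -fh_eigen_rec mulr_suml; apply: eq_bigr => i _.
    by rewrite /beta_value -!mulrA.
  rewrite fh_eigen0 => [|s e]; last by apply: ns; exists s.
  rewrite !mul0r big1 // => i _.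
  have ij : (i <= j)%N by rewrite -ltnS.
  have [[b' jb]|nb] := pselect (exists b, (j - i)%N = b.*2); last first.
    by rewrite cos_pow_coef0 => [|s e]; [rewrite !(mulr0, mul0r)|apply: nb; exists s].
  rewrite fh_eigen0 => [|s e]; first by rewrite !(mulr0, mul0r).
  by apply: ns; exists (s + b')%N; lia.
rewrite -sumrB mulr_suml; apply: (le_trans (ler_norm_sum _ _ _)); apply: ler_sum => i _.
have [] := HC i; first by rewrite -ltnS.
by move=> _; apply.
Qed.

(** On the circle the average is exact; each further complex coordinate costs
    one Riemann sum. *)
Lemma funk_hecke k n j : exists2 C, 0 <= C & funk_hecke_rate k n j C.
Proof.
elim: k j => [|k IH] j; last exact: funk_hecke_step.
exists 0 => // M [|[r b] [|? ?]] // nM _; rewrite normsq_cons /normsq big_nil addr0 /= => _.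
rewrite (@eq_avg _ _ _ (fun t => (r ^+ j / j`!%:R) * (cos (t - b) ^+ j * cos (n%:R * t + 0)))); last first.
  by move=> t; rewrite /hwv /divpow /= expr1n !addr0 !mul1r exprMn; ring.
rewrite avgZ avg_cosX // /hwv /= addr0 /fh_eigen !addn0 expr0 mul1r mul0r.
have [[s js]|ns] := pselect (exists s, j = (n + s.*2)%N).
  have -> : ((j - n)./2 = s)%N by rewrite js addKn doubleK.
  rewrite normr_le0 subr_eq0; apply/eqP.
  by rewrite {1}js exprD -mul2n exprM; ring.
rewrite cos_pow_coef0 => [|s e]; last by apply: ns; exists s.
by rewrite !(mulr0, mul0r) subrr normr0.
Qed.

End FunkHeckeLimit.

(** * Positivity of the Fourier coefficients *)

Section Positivity.
Variable R : realType.
Implicit Types (x y v : seq (R * R)) (Q : {poly R}) (g : R -> R).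

Lemma fcoef_wide Q m N : (size Q <= N)%N -> fcoef Q m = \sum_(j < N) Q`_j * cos_pow_coef R m j.
Proof.
move=> QN; rewrite /fcoef (big_ord_widen N (fun j => Q`_j * cos_pow_coef R m j)) //.
rewrite big_mkcond /=; apply: eq_bigr => j _; case: ltnP => // h.
by rewrite nth_default ?mul0r.
Qed.

(** The link between sphere and circle: the multiplier of [Q^`(k)] on
    harmonics of degree [n] is [2 ^+ k] times a Fourier coefficient of [Q]. *)
Lemma fcoef_fh_eigen Q k n : \sum_(j < size Q) (Q^`(k)`_j * j`!%:R) * fh_eigen R k n j
  = 2 ^+ k * fcoef Q (n + k).
Proof.
rewrite (@fcoef_wide _ _ (k + size Q)) ?leq_addl // big_split_ord /= [X in _ * (X + _)]big1 ?add0r.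
  rewrite mulr_sumr; apply: eq_bigr => j _.
  rewrite coef_derivn /fh_eigen -[_ *+ _]mulr_natr.
  have E : ((k + j) ^_ k)%:R * j`!%:R = (j + k)`!%:R :> R.
    by have := ffact_fact (leq_addr j k); rewrite addKn -natrM => ->; rewrite addnC.
  have -> : Q`_(k + j) * ((k + j) ^_ k)%:R * j`!%:R = Q`_(k + j) * (((k + j) ^_ k)%:R * j`!%:R) by ring.
  by rewrite E (addnC j k); field; exact: fact_neq0.
by move=> i _; rewrite cos_pow_coef0 ?mulr0 // => s; have := ltn_ord i; lia.
Qed.

Lemma funk_hecke_poly k n Q : exists2 C, 0 <= C & exists M0, forall M v, (M0 < M)%N ->
  on_sphere k v ->
  `|sphere_avg k M (fun x => Q^`(k).[dot x v] * hwv n x) - 2 ^+ k * fcoef Q (n + k) * hwv n v| <= C / M%:R.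
Proof.
have : forall j : nat, exists C : R, 0 <= C /\ funk_hecke_rate k n j C.
  by move=> j; have [C ? ?] := @funk_hecke R k n j; exists C.
move=> /choice[C HC].
exists (\sum_(j < size Q) `|Q^`(k)`_j * j`!%:R| * C j).
  by apply: sumr_ge0 => j _; rewrite mulr_ge0 //; case: (HC j).
exists (n + size Q)%N => M v nM [sv nv].
have sq : (size Q^`(k) <= size Q)%N.
  by apply/leq_sizeP => j sj; rewrite coef_derivn nth_default ?mul0rn // (leq_trans sj) ?leq_addl.
rewrite (@eq_sphere_avg _ _ _ _ (fun x => \sum_(j < size Q) (Q^`(k)`_j * j`!%:R) * (divpow j (dot x v) * hwv n x))); last first.
  move=> x _; rewrite (horner_coef_wide _ sq) mulr_suml; apply: eq_bigr => j _.
  by rewrite /divpow; field; exact: fact_neq0.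
rewrite sphere_avg_sum -fcoef_fh_eigen mulr_suml -sumrB mulr_suml.
apply: (le_trans (ler_norm_sum _ _ _)); apply: ler_sum => j _.
rewrite sphere_avgZ -[_ * fh_eigen _ _ _ _ * _]mulrA -mulrBr normrM -[leRHS]mulrA; apply: ler_wpM2l => //.
have [C0 H] := HC j; have := H M v _ sv; rewrite nv expr1n mulr1; apply => //.
by apply: leq_ltn_trans nM; rewrite leq_add2l ltnW.
Qed.

(** A lower bound that does not depend on the number of nodes keeps the
    sign information when the multiplier is divided by it. *)
Lemma sphere_avg_hwv_sq k n : exists2 c : R, 0 < c & exists M0, forall M, (M0 < M)%N ->
  c <= sphere_avg k M (fun x => hwv n x ^+ 2).
Proof.
elim: k => [|k [c c0 [M0 H]]].
  exists (2^-1); first by rewrite invr_gt0.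
  exists (2 * n)%N => M nM /=.
  rewrite (@eq_avg _ _ _ (fun t => 2^-1 * cos ((2 * n)%:R * t + 0) + 2^-1)); last first.
    move=> t; rewrite /hwv /= expr1n mul1r addr0.
    have -> : (2 * n)%:R * t = (n%:R * t) *+ 2 by rewrite natrM; ring.
    by rewrite cos_mulr2n; field.
  rewrite avgD avgZ avg_cos // avg_cst ?(leq_ltn_trans _ nM) // cos0 mulr1 lerDr.
  by rewrite mulr_ge0.
have a0 : (0 : R) < (k + n).+1%:R^-1 by rewrite invr_gt0 ltr0n.
exists (((k + n).+1%:R^-1 / 2) * c); first by rewrite !mulr_gt0.
exists (maxn M0 (2 * (k + n).+1 * 2 ^ (k + n))) => M; rewrite gtn_max => /andP[h1 h2].
have M0' : (0 < M)%N by lia.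
rewrite [X in _ <= X](_ : _ = beta_sum R M (k + n) 0 * sphere_avg k M (fun x => hwv n x ^+ 2)); last first.
  rewrite /= /beta_sum -mulrA; congr (_ * _); rewrite mulr_suml; apply: eq_bigr => i _.
  rewrite -[in RHS]mulrA exprD expr0 mul1r -[in RHS]mulrA; congr (_ * _).
  rewrite -[RHS](avg_cst _ M0'); apply: eq_avg => t.
  rewrite -sphere_avgZ; apply: eq_sphere_avg => x [sx _].
  rewrite hwv_cons ?size_map ?sx // hwv_scale exprMn -exprM mulnC exprM.
  by rewrite sqr_sqrtr // subr_ge0 frac_le1.
apply: ler_pM; [by rewrite mulr_ge0 // ltW | exact: ltW | | exact: H].
have := beta_sum_lim R (k + n) 0 M0'.
rewrite addn0 mulr1 factS natrM invfM mulrCA mulfV ?fact_neq0 // mulr1.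
rewrite ler_norml => /andP[+ _].
have : 2 ^+ (k + n) / M%:R <= (k + n).+1%:R^-1 / 2 :> R; last by move: (_ / M%:R) (_.+1%:R^-1) (beta_sum _ _ _ _) => *; lra.
rewrite ler_pdivrMr ?ltr0n // mulrAC ler_pdivlMr // mulrC.
rewrite ler_pdivlMl ?ltr0n // -natrX -!natrM ler_nat; lia.
Qed.

(** Positive definiteness of [g] on the unit sphere of C^(k+1), with real
    coefficients carried along with the points. *)
Definition pd_profile k g := forall s : seq (R * seq (R * R)),
  (forall p, p \in s -> on_sphere k p.2) ->
  0 <= \sum_(p <- s) \sum_(q <- s) p.1 * q.1 * g (dot p.2 q.2).

(** Stated for a polynomial [Q] whose k-th derivative is only close to [g]:
    the sign is almost preserved, with a constant independent of [Q], so that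
    it survives in the limit. *)
Lemma fcoef_ge0_approx k g n : pd_profile k g -> exists2 C : R, 0 <= C &
  forall Q (e : R), 0 < e -> (forall t : R, -1 <= t <= 1 -> `|Q^`(k).[t] - g t| <= e) ->
  - (C * e) <= fcoef Q (n + k).
Proof.
move=> pd; have [c c0 [M1 Hc]] := sphere_avg_hwv_sq k n.
exists (2 / c); first by rewrite divr_ge0 // ltW.
move=> Q e e0 Qg; have [C C0 [M2 HC]] := funk_hecke_poly k n Q.
pose M := (maxn (maxn M1 M2) (Num.bound (C / e))).+1.
have {}Hc : c <= sphere_avg k M (fun x => hwv n x ^+ 2) by apply: Hc; rewrite /M; lia.
have {}HC v : on_sphere k v ->
  `|sphere_avg k M (fun x => Q^`(k).[dot x v] * hwv n x) - 2 ^+ k * fcoef Q (n + k) * hwv n v| <= e.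
  move=> hv; apply: le_trans (HC M v _ hv) _; first by rewrite /M; lia.
  rewrite ler_pdivrMr ?ltr0n // -ler_pdivrMl // mulrC.
  apply: (@le_trans _ _ (Num.bound (C / e))%:R).
    by apply/ltW/archi_boundP/divr_ge0 => //; apply: ltW.
  by rewrite ler_nat /M; lia.
have [s [E s0 hs]] := sphere_avg_design R k M.
have m1 : \sum_(p <- s) p.1 <= 1.
  have /andP[_] := sphere_avg1 R k M; rewrite E; apply: le_trans.
  by apply: ler_sum => p _; rewrite mulr1.
set l := 2 ^+ k * fcoef Q (n + k) in HC *.
(* The test measure weighs each design point by its harmonic. *)
pose s' := [seq (p.1 * hwv n p.2, p.2) | p <- s].
have P : 0 <= \sum_(p <- s) \sum_(q <- s) p.1 * hwv n p.2 * (q.1 * hwv n q.2) * g (dot p.2 q.2).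
  have := pd s'; rewrite /s' big_map /=.
  under eq_bigr do rewrite big_map /=.
  by apply=> p /mapP[q qs ->] /=; exact: hs.
have hw1 p : p \in s -> `|hwv n p.2| <= 1.
  by move=> /hs [_ h]; rewrite hwv_le1 // h.
have H : 0 <= l * sphere_avg k M (fun x => hwv n x ^+ 2) + (e + e).
  apply: (le_trans P).
  rewrite E mulr_sumr.
  apply: (@le_trans _ _ (\sum_(p <- s) (l * (p.1 * hwv n p.2 ^+ 2) + (e + e) * p.1))); last first.
    by rewrite big_split /= lerD2l -mulr_sumr ler_piMr // addr_ge0 // ltW.
  rewrite !big_seq; apply: ler_sum => p ps.
  have Ep : \sum_(q <- s) p.1 * hwv n p.2 * (q.1 * hwv n q.2) * g (dot p.2 q.2) <=
     p.1 * hwv n p.2 * sphere_avg k M (fun x => Q^`(k).[dot x p.2] * hwv n x) + e * p.1.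
    rewrite E mulr_sumr.
    apply: (@le_trans _ _ (\sum_(q <- s) (p.1 * hwv n p.2 * (q.1 * (Q^`(k).[dot q.2 p.2] * hwv n q.2))
        + (e * p.1) * q.1))); last first.
      by rewrite big_split /= lerD2l -mulr_sumr ler_piMr // mulr_ge0 ?s0 // ltW.
    rewrite !big_seq; apply: ler_sum => q qs.
    rewrite -lerBlDl.
    have -> : dot p.2 q.2 = dot q.2 p.2.
      elim: (p.2) (q.2) => [|a x IH] [|b y] //=.
      by rewrite IH -cosN opprB; ring.
    have -> : p.1 * hwv n p.2 * (q.1 * hwv n q.2) * g (dot q.2 p.2) -
     p.1 * hwv n p.2 * (q.1 * (Q^`(k).[dot q.2 p.2] * hwv n q.2)) =
     (p.1 * q.1) * (hwv n p.2 * hwv n q.2 * (g (dot q.2 p.2) - Q^`(k).[dot q.2 p.2])) by ring.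
    have -> : e * p.1 * q.1 = (p.1 * q.1) * e by ring.
    apply: ler_wpM2l; first by rewrite mulr_ge0 ?s0.
    apply: le_trans (ler_norm _) _; rewrite normrM (normrM (hwv n p.2)) distrC.
    have d1 : -1 <= dot q.2 p.2 <= 1.
      rewrite -ler_norml; apply: le_trans (le_dot _ _) _.
      have [[_ ->] [_ ->]] := (hs _ ps, hs _ qs); lra.
    by apply: le_trans (Qg _ d1); apply: ler_piMl => //; apply: mulr_ile1; rewrite ?hw1.
  apply: (le_trans Ep).
  have -> : l * (p.1 * hwv n p.2 ^+ 2) = p.1 * hwv n p.2 * (l * hwv n p.2) by ring.
  rewrite -lerBlDl addrAC -mulrBr.
  have -> : (e + e) * p.1 = p.1 * e + e * p.1 by ring.
  rewrite lerD2r -mulrA; apply: ler_wpM2l; first exact: s0.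
  apply: le_trans (ler_norm _) _; rewrite normrM; apply: le_trans (HC _ (hs _ ps)).
  by rewrite ler_piMl ?hw1.
have l0 : - (2 / c * e) <= l.
  rewrite leNgt; apply/negP => lc.
  have : l * sphere_avg k M (fun x => hwv n x ^+ 2) < - (e + e); last by lra.
  have l0 : l < 0 by apply: lt_le_trans lc _; rewrite oppr_le0 mulr_ge0 ?divr_ge0 // ltW.
  apply: le_lt_trans (_ : l * c < _); first by rewrite ler_nM2l.
  have -> : - (e + e) = - (2 / c * e) * c by field; rewrite lt0r_neq0.
  by rewrite ltr_pM2r.
have k1 : (1 : R) <= 2 ^+ k by rewrite exprn_ege1 // ler1n.
have [f0|f0] := leP 0 (fcoef Q (n + k)).
  by apply: le_trans f0; rewrite oppr_le0 mulr_ge0 ?divr_ge0 // ltW.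
by apply: (le_trans l0); rewrite /l -[leRHS]mul1r ler_wnM2r // ltW.
Qed.
End Positivity.

(** * Limits with a rate, and functions of class C^n on (0, pi) *)

Section UniformLimits.
Local Open Scope classical_set_scope.
Variable R : realType.
Implicit Types (f g : R -> R) (e : nat -> R).

Definition null_seq e := forall eps : R, 0 < eps -> exists N0, forall N, (N0 <= N)%N -> e N <= eps.

Lemma le_null (e : nat -> R) (u v : R) : null_seq e -> (forall N, u <= v + e N) -> u <= v.
Proof.
move=> e0 H; apply/ler_addgt0Pr => eps eps0.
have [N /(_ _ (leqnn N)) eN] := e0 _ eps0.
by apply: (le_trans (H N)); rewrite lerD2l.
Qed.

(** The limit is the supremum of the lower bounds [u N - e N]. *)
Lemma limit_of_rate (u e : nat -> R) :
  (forall N M, `|u N - u M| <= e N + e M) -> exists l, forall N, `|u N - l| <= e N.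
Proof.
move=> H; pose A : set R := range (fun N => u N - e N).
have ubA M : ubound A (u M + e M).
  move=> _ [N _ <-]; have := H N M; rewrite ler_norml => /andP[_]; lra.
exists (sup A) => N; rewrite ler_norml; apply/andP; split.
  have : sup A <= u N + e N; last by lra.
  by apply: ge_sup => //; exists (u 0%N - e 0%N), 0%N.
have : u N - e N <= sup A; last by lra.
apply: sup_upper_bound; last by exists N.
by split; [exists (u 0%N - e 0%N), 0%N | exists (u 0%N + e 0%N); exact: ubA].
Qed.

Lemma continuous_unif_lim (F : nat -> R -> R) f e : null_seq e ->
  (forall N x, `|F N x - f x| <= e N) -> (forall N, continuous (F N)) -> continuous f.
Proof.
move=> e0 H Fc x; apply/cvgrPdist_le => eps eps0.
have [N /(_ _ (leqnn N)) eN] := e0 (eps / 3) (divr_gt0 eps0 (ltr0n _ 3)).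
have e3 : 0 < eps / 3 by rewrite divr_gt0.
have /cvgrPdist_le/(_ _ e3) := Fc N x.
apply: filterS => y Fy.
have := H N x; have := H N y.
move: Fy eN; rewrite !ler_norml => /andP[? ?] ? /andP[? ?] /andP[? ?].
by apply/andP; split; lra.
Qed.

Lemma MVT_sym f (df : R -> R) (x z : R) : (forall y : R, is_derive y 1 f (df y)) ->
  exists2 c, `|c - x| <= `|z - x| & f z - f x = df c * (z - x).
Proof.
move=> fd.
have fc : continuous f.
  move=> y; by apply/differentiable_continuous/derivable1_diffP; have [] := fd y.
case: (ltgtP x z) => [xz|zx|->].
- have [c cxz E] := MVT xz (fun y _ => fd y) (continuous_subspaceT fc).
  exists c => //; move: cxz; rewrite in_itv /= => /andP[? ?].
  by rewrite !ger0_norm; lra.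
- have [c cxz E] := MVT zx (fun y _ => fd y) (continuous_subspaceT fc).
  exists c; last by rewrite -opprB E -mulrN opprB.
  move: cxz; rewrite in_itv /= => /andP[? ?].
  by rewrite !ler0_norm; lra.
- by exists z; rewrite ?subrr ?mulr0.
Qed.

Lemma is_derive_small f (x d : R) :
  (forall eps, 0 < eps -> \forall z \near x, `|f z - f x - d * (z - x)| <= eps * `|z - x|) ->
  is_derive x 1 f d.
Proof.
move=> H; apply/is_derive1_caratheodory.
exists (fun z => if z == x then d else (f z - f x) / (z - x)); split; last by rewrite eqxx.
  move=> z; case: eqP => [->|/eqP zx]; first by rewrite !subrr mulr0.
  by rewrite divfK // subr_eq0.
apply/cvgrPdist_le => eps eps0; have := H _ eps0.
apply: filterS => z; rewrite eqxx; case: eqP => [->|/eqP zx] Hz.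
  by rewrite subrr normr0 ltW.
have zx0 : 0 < `|z - x| by rewrite normr_gt0 subr_eq0.
rewrite -(ler_pM2r zx0); apply: le_trans Hz.
rewrite -normrM distrC mulrBl divfK ?subr_eq0 //.
Qed.

(** The mean value theorem for [F N] gives
    f z - f x - g x (z - x) = o(z - x) after letting [N] grow. *)
Lemma is_derive_unif_lim (F G : nat -> R -> R) f g e : null_seq e ->
  (forall N x, `|F N x - f x| <= e N) -> (forall N x, `|G N x - g x| <= e N) ->
  (forall N (x : R), is_derive x 1 (F N) (G N x)) -> continuous g ->
  forall x : R, is_derive x 1 f (g x).
Proof.
move=> e0 HF HG FG gc x; apply: is_derive_small => eps eps0.
have e2 : 0 < eps / 2 by rewrite divr_gt0.
have /cvgrPdist_le/(_ _ e2) := gc x.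
move=> /nbhs_ballP[dl /= dl0 Hd].
near=> z.
have zx : `|z - x| < dl.
  by rewrite distrC; near: z; exact: nbhsx_ballx.
have [->|zx0] := eqVneq z x; first by rewrite !subrr mulr0 subr0 !normr0 mulr0.
have {}zx0 : 0 < `|z - x| by rewrite normr_gt0 subr_eq0.
apply/ler_addgt0Pr => r r0.
have m0 : 0 < Num.min (r / 2) (eps / 2) by rewrite lt_min !divr_gt0.
have [N /(_ _ (leqnn N))] := e0 _ m0; rewrite le_min => /andP[er eN].
apply: le_trans (_ : _ <= eps * `|z - x|  + (e N + e N)) _; last by rewrite lerD2l; lra.
have [c cx E] := MVT_sym x z (FG N).
have -> : f z - f x - g x * (z - x) = (G N c - g x) * (z - x) +
     ((F N x - f x) - (F N z - f z)).
  by rewrite mulrBl -E; ring.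
apply: (le_trans (ler_normD _ _)); apply: lerD; last first.
  by apply: (le_trans (ler_normB _ _)); rewrite lerD.
rewrite normrM ler_wpM2r //.
have -> : G N c - g x = (G N c - g c) - (g x - g c) by ring.
have := HG N c; have : `|g x - g c| <= eps / 2.
  by apply: Hd; rewrite /ball /= distrC (le_lt_trans cx).
move=> h1 h2; apply: (le_trans (ler_normB _ _)); lra.
Unshelve. all: by end_near. Qed.

End UniformLimits.

Section Smooth.
Local Open Scope classical_set_scope.
Variable R : realType.
Implicit Types (f g : R -> R).
Local Notation I := (`]0, pi[%R : interval R).

(** Class C^n on the open interval (0, pi), by recursion on [n]. *)
Fixpoint Cn (n : nat) f : Prop :=
  match n with
  | 0 => {in I, continuous f}
  | n'.+1 => {in I, forall x : R, derivable f x 1} /\ Cn n' f^`()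
  end.

Lemma near_itv x : x \in I -> \forall y \near x, y \in I.
Proof. by move=> xI; exact: near_in_itvoo. Qed.

Lemma Cn_ext n f g : {in I, f =1 g} -> Cn n f -> Cn n g.
Proof.
elim: n f g => [|n IH] f g fg /=.
  move=> fc x xI; have := fc x xI; rewrite /continuous_at -fg //.
  apply: cvg_trans; apply: near_eq_cvg.
  by apply: filterS (near_itv xI) => y /fg.
have nfg x : x \in I -> {near x, f =1 g} by move=> xI; apply: filterS (near_itv xI) => y /fg.
move=> [fd fC]; split=> [x xI|]; first exact: near_eq_derivable (nfg x xI) (fd x xI).
apply: IH fC => x xI; rewrite !derive1E.
exact: near_eq_derive (nfg x xI).
Qed.

Lemma Cn_is_derive n f g : {in I, forall x : R, is_derive x 1 f (g x)} -> Cn n g -> Cn n.+1 f.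
Proof.
move=> fg gC; split=> [x xI|]; first by have [] := fg x xI.
by apply: Cn_ext gC => x xI; rewrite derive1E; have [_ ->] := fg x xI.
Qed.

Lemma Cn_derive n f g : {in I, forall x : R, is_derive x 1 f (g x)} -> Cn n.+1 f -> Cn n g.
Proof.
move=> fg [_ fC]; apply: Cn_ext fC => x xI.
by rewrite derive1E; have [_ ->] := fg x xI.
Qed.

Lemma CnW n f : Cn n.+1 f -> Cn n f.
Proof.
elim: n f => [|n IH] f [fd fC].
  by move=> x xI; apply/differentiable_continuous/derivable1_diffP/fd.
by split=> //; apply: IH.
Qed.

Lemma CnD n f g : Cn n f -> Cn n g -> Cn n (fun x => f x + g x).
Proof.
elim: n f g => [|n IH] f g.
  by move=> fc gc x xI; apply: cvgD; [exact: fc|exact: gc].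
move=> [fd fC] [gd gC]; apply: Cn_is_derive (IH _ _ fC gC) => x xI.
by apply: is_deriveD; rewrite derive1E; apply/derivableP; [exact: fd|exact: gd].
Qed.

Lemma CnM n f g : Cn n f -> Cn n g -> Cn n (fun x => f x * g x).
Proof.
elim: n f g => [|n IH] f g.
  by move=> fc gc x xI; apply: cvgM; [exact: fc|exact: gc].
move=> fC gC; have [[fd fC'] [gd gC']] := (fC, gC).
have H : {in I, forall x : R, is_derive x 1 (fun x => f x * g x) (f x * derive1 g x + g x * derive1 f x)}.
  move=> x xI; apply: is_deriveM; rewrite derive1E; apply/derivableP; [exact: fd|exact: gd].
apply: Cn_is_derive H _.
by apply: CnD; apply: IH => //; exact: CnW.
Qed.

Lemma Cn_cst n (c : R) : Cn n (fun=> c).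
Proof.
elim: n c => [|n IH] c; first by move=> x _; exact: cvg_cst.
by apply: Cn_is_derive (IH 0) => x _; exact: is_derive_cst.
Qed.

Lemma Cn_cos_sin n : Cn n (@cos R) /\ Cn n (@sin R).
Proof.
elim: n => [|n [IHc IHs]].
  by split=> x _; [exact: continuous_cos | exact: continuous_sin].
split; last by apply: Cn_is_derive IHc => x _; exact: is_derive_sin.
apply: (@Cn_is_derive _ _ (fun x => -1 * sin x)); last exact: CnM (Cn_cst _ _) IHs.
by move=> x _; rewrite mulN1r; exact: is_derive_cos.
Qed.

Lemma sin_neq0 x : x \in I -> sin x != 0.
Proof. by rewrite in_itv /= => xI; rewrite gt_eqF // sin_gt0_pi. Qed.

Lemma Cn_sinV n : Cn n (fun x : R => (sin x)^-1).
Proof.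
elim: n => [|n IH].
  by move=> x xI; apply: cvgV; [exact: sin_neq0 | exact: continuous_sin].
apply: (@Cn_is_derive _ _ (fun x => -1 * cos x * ((sin x)^-1 * (sin x)^-1))); last first.
  by apply: CnM; apply: CnM => //; [exact: Cn_cst | have [] := Cn_cos_sin n].
move=> x xI; have := is_deriveV (sin_neq0 xI) (is_derive_sin x).
by rewrite /GRing.scale /= => h; apply: is_derive_eq h _; rewrite expr2 invfM; ring.
Qed.

Lemma has_continuous_derivative_Cn n f : Cn n f -> has_continuous_derivative n 0 pi f.
Proof.
rewrite /has_continuous_derivative.
elim: n f => [|n IH] f.
  by move=> fc; split=> // x; rewrite inE /= => xI; exact: fc.
move=> [fd /IH[h1 h2]].
have E j : f^`(j.+1) = f^`()^`(j) by rewrite /derive1n iterSr.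
split; last by rewrite E.
case=> [|j] jn x xI; last by rewrite E; exact: h1.
by move: xI; rewrite inE /= => xI; exact: fd.
Qed.

End Smooth.

(** * Primitives vanishing at 1, and symmetric differences *)

Section Primitives.
Variable R : realType.
Implicit Types (p q P : {poly R}) (s t B e : R).

Definition prim p : {poly R} :=
  let P := 'X * \poly_(i < size p) (p`_i / i.+1%:R) in P - (P.[1])%:P.

Lemma deriv_prim p : (prim p)^`() = p.
Proof.
rewrite /prim derivB derivC subr0; apply/polyP => i.
rewrite coef_deriv coefXM /= coef_poly; case: ltnP => [_|sp].
  by rewrite -[_ *+ _]mulr_natr divfK // pnatr_eq0.
by rewrite mul0rn nth_default.
Qed.

Lemma prim_at1 p : (prim p).[1] = 0.
Proof. by rewrite /prim hornerD hornerN hornerC subrr. Qed.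

Lemma derivn_iter_prim k p : (iter k prim p)^`(k) = p.
Proof. by elim: k => // k IH; rewrite iterS derivSn deriv_prim. Qed.

Lemma poly_MVT P s t : s < t ->
  exists2 c, s < c < t & P.[t] - P.[s] = P^`().[c] * (t - s).
Proof.
move=> st; have Pc : continuous (horner P) by move=> x; exact: continuous_horner.
have [c] := MVT st (fun x _ => is_derive_poly P x) (continuous_subspaceT Pc).
by rewrite in_itv; exists c.
Qed.

Lemma poly_lipschitz P B : (forall t, -1 <= t <= 1 -> `|P^`().[t]| <= B) ->
  forall s t, -1 <= s <= 1 -> -1 <= t <= 1 -> `|P.[s] - P.[t]| <= B * `|s - t|.
Proof.
move=> HB; suff H s t : -1 <= s <= 1 -> -1 <= t <= 1 -> s < t -> `|P.[s] - P.[t]| <= B * `|s - t|.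
  move=> s t hs ht; case: (ltgtP s t) => [st|ts|->].
  - exact: H.
  - by rewrite distrC (distrC s); exact: H.
  - by rewrite !subrr normr0 mulr0.
move=> /andP[? ?] /andP[? ?] st; have [c /andP[? ?] E] := poly_MVT P st.
by rewrite distrC E normrM (distrC s) ler_wpM2r // HB //; apply/andP; split; lra.
Qed.

(** Iterating this makes the k-fold primitive vanish to order [k] at 1. *)
Lemma vanish_at_1 P B j : P.[1] = 0 ->
  (forall t, -1 <= t <= 1 -> `|P^`().[t]| <= B * (1 - t) ^+ j) ->
  forall t, -1 <= t <= 1 -> `|P.[t]| <= B * (1 - t) ^+ j.+1.
Proof.
move=> P1 HB t ht; have /andP[t0] := ht; rewrite le_eqVlt => /orP[/eqP ->|t1].
  by rewrite P1 normr0 subrr expr0n mulr0.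
have [c /andP[tc c1] E] := poly_MVT P t1.
have B0 : 0 <= B.
  have := HB t ht; rewrite -(pmulr_lge0 B (x := (1 - t) ^+ j)) ?exprn_gt0 ?subr_gt0 //.
  exact: le_trans.
move: E; rewrite P1 sub0r => E; have h1 : 0 <= 1 - t by lra.
rewrite -normrN E normrM (ger0_norm h1) exprSr mulrA ler_wpM2r //.
have c01 : -1 <= c <= 1 by apply/andP; split; lra.
apply: (le_trans (HB _ c01)); rewrite ler_wpM2l // lerXn2r ?nnegrE; lra.
Qed.

Lemma iter_prim_diff j p q e : (forall t, -1 <= t <= 1 -> `|p.[t] - q.[t]| <= e) ->
  forall t, -1 <= t <= 1 -> `|(iter j prim p).[t] - (iter j prim q).[t]| <= e * (1 - t) ^+ j.
Proof.
move=> H; elim: j => [|j IH] t ht; first by rewrite mulr1 H.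
rewrite -hornerN -hornerD; apply: vanish_at_1 => //=.
  by rewrite hornerD hornerN !prim_at1 subrr.
by move=> u hu; rewrite derivB !deriv_prim hornerD hornerN IH.
Qed.

Lemma iter_prim_bound j p e : (forall t, -1 <= t <= 1 -> `|p.[t]| <= e) ->
  forall t, -1 <= t <= 1 -> `|(iter j prim p).[t]| <= e * (1 - t) ^+ j.
Proof.
move=> H; elim: j => [|j IH] t ht; first by rewrite mulr1 H.
by apply: vanish_at_1 => //=; [exact: prim_at1 | move=> u hu; rewrite deriv_prim IH].
Qed.

End Primitives.

Section Differences.
Variable R : realType.
Implicit Types (f : R -> R) (x h : R) (a c : nat -> R).

Lemma sin_lower (z : R) : 0 <= z <= 1 -> z * cos 1 <= sin z.
Proof.
move=> /andP[z0 z1]; move: z0; rewrite le_eqVlt => /orP[/eqP <-|z0].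
  by rewrite mul0r sin0.
have [y yz E] := MVT z0 (fun y _ => is_derive_sin y) (continuous_subspaceT (@continuous_sin R)).
move: E; rewrite sin0 !subr0 => ->; rewrite mulrC ler_wpM2r ?(ltW z0) //.
move: yz; rewrite in_itv /= => /andP[y0 yz].
have p2 := pi_ge2 R.
by apply/ltW; rewrite ltr_cos ?in_itv /=; lra.
Qed.

Lemma one_sub_cosE (y : R) : 2 * (1 - cos y) = (2 * sin (y / 2)) ^+ 2.
Proof.
have {1}-> : y = (y / 2) *+ 2 by field.
by rewrite cos_mulr2n cos2sin2; ring.
Qed.

Lemma one_sub_cos_lower (y : R) : 0 <= y <= 1 -> (cos 1 * y) ^+ 2 <= 2 * (1 - cos y).
Proof.
move=> /andP[y0 y1]; rewrite one_sub_cosE.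
have c0 := cos1_gt0 R.
have : (y / 2) * cos 1 <= sin (y / 2) by apply: sin_lower; lra.
move=> H; have a0 : 0 <= cos 1 * y by rewrite mulr_ge0 // ltW.
have b0 : cos 1 * y <= 2 * sin (y / 2) by lra.
by rewrite lerXn2r ?nnegrE // (le_trans a0).
Qed.

Lemma sin_upper (z : R) : `|sin z| <= `|z|.
Proof.
have [c _ E] := @MVT_sym R sin cos 0 z (@is_derive_sin R).
move: E; rewrite sin0 !subr0 => ->.
by rewrite normrM ler_piMl // cos_max.
Qed.

Lemma one_sub_cos_upper (y : R) : 2 * (1 - cos y) <= y ^+ 2.
Proof.
rewrite one_sub_cosE -real_normK ?num_real // -[leRHS]real_normK ?num_real //.
rewrite lerXn2r ?nnegrE // normrM ger0_norm //.
have := sin_upper (y / 2); rewrite normrM (@ger0_norm _ 2^-1) ?invr_ge0 //; lra.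
Qed.

(** The negative of a second symmetric difference: it multiplies [cos (m x)]
    by the nonnegative number [2 * (1 - cos (m * h))]. *)
Definition sdiff h f x : R := 2 * f x - f (x + h) - f (x - h).

Definition cos_sum L c x : R := \sum_(m < L) c m * cos (m%:R * x).

Lemma iter_sdiff_cos_sum h k L c x :
  iter k (sdiff h) (cos_sum L c) x = cos_sum L (fun m => c m * (2 * (1 - cos (m%:R * h))) ^+ k) x.
Proof.
elim: k x => [|k IH] x; first by apply: eq_bigr => m _; rewrite expr0 mulr1.
rewrite iterS /sdiff !IH /cos_sum mulr_sumr -!sumrB; apply: eq_bigr => m _.
rewrite (mulrDr m%:R x h) (mulrBr m%:R x h) cosB cosD exprS; ring.
Qed.

Lemma iter_sdiff_bound h k f r B : 0 <= h ->
  (forall x, `|x| <= r + k%:R * h -> `|f x| <= B) ->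
  forall x, `|x| <= r -> `|iter k (sdiff h) f x| <= 4 ^+ k * B.
Proof.
move=> h0; elim: k f B => [|k IH] f B H x xr.
  by rewrite mul1r; apply: H; rewrite mul0r addr0.
rewrite iterSr exprSr -mulrA; apply: IH => // y yr.
have kr : r + k.+1%:R * h = r + k%:R * h + h by rewrite -natr1; ring.
have H0 : `|f y| <= B by apply: H; lra.
have H1 : `|f (y + h)| <= B.
  by apply: H; rewrite kr; apply: (le_trans (ler_normD _ _)); rewrite (ger0_norm h0) lerD2r.
have H2 : `|f (y - h)| <= B.
  by apply: H; rewrite kr; apply: (le_trans (ler_normB _ _)); rewrite (ger0_norm h0) lerD2r.
rewrite /sdiff; move: H0 H1 H2; rewrite !ler_norml => /andP[? ?] /andP[? ?] /andP[? ?].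
by apply/andP; split; lra.
Qed.

Lemma iter_sdiffB h k f g x :
  iter k (sdiff h) f x - iter k (sdiff h) g x = iter k (sdiff h) (fun y => f y - g y) x.
Proof.
elim: k x => // k IH x; rewrite !iterS /sdiff -!IH; ring.
Qed.

End Differences.

(** * Summability from the behaviour at the origin *)

Section Summability.
Variable R : realType.
Implicit Types (f h : R -> R) (x : R) (a c : nat -> R).

(** [a] is the sequence of Fourier coefficients of [h], in the sense that its
    Fejer means converge uniformly to [h].  Convergence of the series itself is
    only known once its coefficients are summable. *)
Definition fejer_limit a h := forall eps : R, 0 < eps -> exists L0, forall L, (L0 <= L)%N ->
  forall x, `|fejer_sum L a x - h x| <= eps.

Lemma fejer_sum_cos_sum L a : fejer_sum L a =1 cos_sum L (fun m => cos_weight R m * (1 - m%:R / L%:R) * a m).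
Proof. by move=> x; apply: eq_bigr => m _; rewrite mulrA. Qed.

Lemma iter_sdiff_ext (h0 : R) k f g x : f =1 g -> iter k (sdiff h0) f x = iter k (sdiff h0) g x.
Proof. by move=> fg; congr (iter k _ _ x); apply/funext. Qed.

Lemma sum_indicator (L n : nat) (F : nat -> R) : (n <= L)%N ->
  \sum_(m < L) (m < n)%:R * F m = \sum_(m < n) F m.
Proof.
move=> nL; rewrite (big_ord_widen L F nL) [RHS]big_mkcond /=; apply: eq_bigr => m _.
by case: (m < n)%N; rewrite ?mul1r ?mul0r.
Qed.

(** Apply [sdiff] k times to the Fejer means at the origin, with step
    1 / (n + 1).  The left side is a sum of terms that are nonnegative for
    [m >= k], the right side is O(n^(-2k)) because [h] vanishes to order [2 * k]
    at the origin. *)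
Lemma fejer_limit_summable k a h (B : R) : 0 <= B -> fejer_limit a h ->
  (forall m, (k <= m)%N -> 0 <= a m) ->
  (forall x, `|h x| <= B * (1 - cos x) ^+ k) ->
  exists C : R, forall n, \sum_(m < n) `|a m| * (m%:R ^+ 2) ^+ k <= C.
Proof.
move=> B0 Ha apos hB.
pose A0 := \sum_(m < k) `|a m| * (m%:R ^+ 2) ^+ k.
have A00 : 0 <= A0 by apply: sumr_ge0 => m _; rewrite mulr_ge0 ?exprn_ge0 ?sqr_ge0.
pose cc : R := (cos 1 ^+ 2) ^+ k.
have cc0 : 0 < cc by rewrite !exprn_gt0 // cos1_gt0.
have cc1 : cc <= 1 by rewrite exprn_ile1 ?sqr_ge0 // exprn_ile1 ?cos_le1 // ltW // cos1_gt0.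
exists ((2 / cc) * (4 ^+ k * (B * (k%:R ^+ 2) ^+ k + 1) + 3 * A0)) => n.
pose h0 : R := n.+1%:R^-1.
have h00 : 0 < h0 by rewrite invr_gt0 ltr0n.
pose hh := (h0 ^+ 2) ^+ k.
have hh0 : 0 < hh by rewrite !exprn_gt0.
have [L0 HL0] := Ha hh hh0.
pose L := maxn L0 (maxn (2 * n.+1) k).
have L0L : (L0 <= L)%N by rewrite /L; lia.
have nL : (2 * n.+1 <= L)%N by rewrite /L; lia.
have kL : (k <= L)%N by rewrite /L; lia.
have Lp : 0 < L%:R :> R by rewrite ltr0n; lia.
pose c (m : nat) := cos_weight R m * (1 - m%:R / L%:R) * a m.
pose w (m : nat) := 2 * (1 - cos (m%:R * h0)).
have w0 m : 0 <= w m by rewrite mulr_ge0 // subr_ge0 cos_le1.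
pose T := \sum_(m < L) c m * w m ^+ k.
have ET : T = iter k (sdiff h0) (fejer_sum L a) 0.
  rewrite (iter_sdiff_ext _ _ _ (@fejer_sum_cos_sum L a)) iter_sdiff_cos_sum /T /cos_sum.
  by apply: eq_bigr => m _; rewrite mulr0 cos0 mulr1.
have XE m : ((m%:R * h0) ^+ 2) ^+ k = (m%:R ^+ 2) ^+ k * hh by rewrite /hh -[RHS]exprMn -exprMn.
have TB : T <= 4 ^+ k * (B * (k%:R ^+ 2) ^+ k + 1) * hh.
  have -> : T = iter k (sdiff h0) h 0 + iter k (sdiff h0) (fun y => fejer_sum L a y - h y) 0.
    by rewrite -iter_sdiffB ET addrC subrK.
  have -> : 4 ^+ k * (B * (k%:R ^+ 2) ^+ k + 1) * hh =
    4 ^+ k * (B * (k%:R ^+ 2) ^+ k * hh) + 4 ^+ k * hh by ring.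
  apply: lerD; apply: (le_trans (ler_norm _)); apply: (iter_sdiff_bound (r := 0) (ltW h00)); rewrite ?normr0 //.
    move=> x; rewrite add0r => xk; apply: (le_trans (hB x)).
    rewrite -mulrA -XE ler_wpM2l // lerXn2r ?nnegrE ?sqr_ge0 ?subr_ge0 ?cos_le1 //.
    apply: (@le_trans _ _ (2 * (1 - cos x))); first by have := cos_le1 x; lra.
    apply: (le_trans (one_sub_cos_upper x)).
    by rewrite -real_normK ?num_real // lerXn2r ?nnegrE ?mulr_ge0 ?(ltW h00).
  by move=> x _; exact: HL0.
(* For [k <= m < n] the Fejer weight is at least 1/2 as [L >= 2 n], and
   [m * h0 <= 1] gives [w m >= (cos 1 * m * h0)^2].  The finitely many terms with
   [m < k], whose sign is unknown, are moved to the right. *)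
have S : forall m : 'I_L, (m < n)%:R * (2^-1 * cc * (`|a m| * (m%:R ^+ 2) ^+ k)) * hh <=
    c m * w m ^+ k + (m < k)%:R * (3 * (`|a m| * (m%:R ^+ 2) ^+ k)) * hh.
  move=> m; set X := (m%:R ^+ 2) ^+ k.
  have X0 : 0 <= X by rewrite exprn_ge0 ?sqr_ge0.
  have aX0 : 0 <= `|a m| * X * hh by rewrite !mulr_ge0 // ltW.
  have f0 : 0 <= 1 - m%:R / L%:R :> R by exact: fejer_weight_ge0.
  have em0 := cos_weight_ge0 R m.
  have f1 : 1 - m%:R / L%:R <= 1 :> R by rewrite lerBlDr lerDl divr_ge0.
  have wX : w m ^+ k <= X * hh.
    by rewrite -XE lerXn2r ?nnegrE ?sqr_ge0 //; exact: one_sub_cos_upper.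
  have [km|mk] := leqP k m.
    rewrite mul0r mul0r addr0.
    have ccm : 0 <= c m by rewrite /c !mulr_ge0 // apos.
    case: ltnP => mn; last first.
      by rewrite !mul0r mulr_ge0 ?exprn_ge0.
    have f2 : 2^-1 <= 1 - m%:R / L%:R :> R.
      have : m%:R / L%:R <= 2^-1 :> R; last by lra.
      rewrite ler_pdivrMr // ler_pdivlMl // -natrM ler_nat.
      by apply: leq_trans nL; rewrite leq_mul2l /= ltnW // ltnW.
    have em1 : 1 <= cos_weight R m by rewrite /cos_weight; case: (nat_of_ord m) => [|?]; lra.
    rewrite mul1r (ger0_norm (apos _ km)).
    have h1 : 2^-1 * a m <= c m.
      rewrite /c ler_wpM2r ?apos //; apply: (le_trans f2); exact: ler_peMl.
    have h2 : cc * (X * hh) <= w m ^+ k.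
      have -> : cc * (X * hh) = ((cos 1 * (m%:R * h0)) ^+ 2) ^+ k.
        by rewrite /X -XE /cc -exprMn -exprMn.
      rewrite lerXn2r ?nnegrE ?sqr_ge0 //.
      apply: one_sub_cos_lower; rewrite mulr_ge0 ?(ltW h00) //=.
      by rewrite /h0 ler_pdivrMr ?ltr0n // mul1r ler_nat ltnW // ltnW.
    have -> : 2^-1 * cc * (a m * X) * hh = (2^-1 * a m) * (cc * (X * hh)) by ring.
    apply: ler_pM => //; first by rewrite mulr_ge0 ?apos.
    by rewrite !mulr_ge0 // ltW.
  have em2 : cos_weight R m <= 2 by rewrite /cos_weight; case: (nat_of_ord m) => [|?]; lra.
  have h1 : `|c m * w m ^+ k| <= 2 * (`|a m| * X * hh).
    rewrite normrM (@ger0_norm _ (w m ^+ k)) ?exprn_ge0 //.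
    have -> : 2 * (`|a m| * X * hh) = (2 * `|a m|) * (X * hh) by ring.
    apply: ler_pM => //; first by rewrite exprn_ge0.
    rewrite /c normrM ler_wpM2r // ger0_norm ?mulr_ge0 //.
    by rewrite -[leRHS]mulr1; apply: ler_pM.
  move: h1; rewrite ler_norml => /andP[h1 _].
  have h3 : (m < n)%:R * (2^-1 * cc * (`|a m| * X)) * hh <= `|a m| * X * hh.
    have -> : (m < n)%:R * (2^-1 * cc * (`|a m| * X)) * hh =
      ((m < n)%:R * (2^-1 * cc)) * (`|a m| * X * hh) by ring.
    apply: ler_piMl => //; case: (m < n)%N; rewrite ?mul1r ?mul0r //; lra.
  by rewrite mul1r; lra.
have {}S : \sum_(m < L) _ <= \sum_(m < L) _ := ler_sum _ (fun m _ => S m).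
move: S; rewrite big_split /= -!mulr_suml -/T.
rewrite (sum_indicator (fun m => 2^-1 * cc * (`|a m| * (m%:R ^+ 2) ^+ k))); last by lia.
rewrite (sum_indicator (fun m => 3 * (`|a m| * (m%:R ^+ 2) ^+ k))) //.
rewrite -!mulr_sumr -/A0 => S.
have {}S := le_trans S (lerD TB (lexx _)).
rewrite -mulrDl ler_pM2r // in S.
set Z := \sum_(m < n) _ in S *.
have -> : Z = (2 / cc) * (2^-1 * cc * Z) by field; rewrite lt0r_neq0.
by rewrite ler_wpM2l // divr_ge0 // ltW.
Qed.
End Summability.

(** * Smoothness of cosine series *)

Section CosineSeries.
Variable R : realType.
Implicit Types (f h : R -> R) (x : R) (a c b : nat -> R).

Lemma null_seq_inv (C : R) : 0 <= C -> null_seq (fun N => C / N.+1%:R).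
Proof.
move=> C0 eps eps0; exists (Num.bound (C / eps)).
move=> N hN; rewrite ler_pdivrMr ?ltr0n // mulrC -ler_pdivrMr //.
apply: (@le_trans _ _ (Num.bound (C / eps))%:R); last by rewrite ler_nat leqW.
by apply/ltW/archi_boundP; rewrite divr_ge0 // ltW.
Qed.

(** The rate is the remainder of the series of majorants.  The index 0 is
    exempt from the majorization: it belongs to every partial sum that occurs,
    so its term cancels. *)
Lemma tail_rate b (C : R) : (forall m, 0 <= b m) -> (forall n, \sum_(m < n) b m <= C) ->
  exists2 T : nat -> R, null_seq T &
    forall c N M, (forall m, (0 < m)%N -> `|c m| <= b m) ->
     `|\sum_(m < N.+1) c m - \sum_(m < M.+1) c m| <= T N + T M.
Proof.
move=> b0 bC; pose S (n : nat) := \sum_(m < n.+1) b m.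
pose A : set R := range S.
have ubA : ubound A C by move=> _ [N _ <-]; exact: bC.
have A0 : (A !=set0)%classic by exists (S 0%N), 0%N.
have supA : has_sup A by split=> //; exists C.
exists (fun N => sup A - S N).
  move=> eps eps0; have [_ [N _ <-] HN] := sup_adherent eps0 supA.
  exists N => M NM; have : S N <= S M; last by lra.
  rewrite /S (big_ord_widen M.+1 b) // big_mkcond /=; apply: ler_sum => i _.
  by case: ltnP.
have Sle N : S N <= sup A by apply: sup_upper_bound => //; exists N.
move=> c N M hc.
wlog NM : N M / (N <= M)%N.
  move=> H; case: (leqP N M) => [|/ltnW] NM; first exact: H.
  by rewrite distrC [leRHS]addrC; exact: H.
have E (F : nat -> R) : \sum_(m < M.+1) F m = \sum_(m < N.+1) F m + \sum_(N.+1 <= m < M.+1) F m :> R.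
  by rewrite -!(big_mkord xpredT F) -big_cat_nat.
rewrite E opprD addrA subrr add0r normrN.
apply: (@le_trans _ _ (S M - S N)); last by have := Sle M; have := Sle N; lra.
rewrite /S E addrAC subrr add0r.
apply: (le_trans (ler_norm_sum _ _ _)).
rewrite big_nat_cond [leRHS]big_nat_cond; apply: ler_sum => m /andP[/andP[Nm _] _].
by apply: hc; apply: leq_trans Nm.
Qed.

(** The [j]-th derivative of a cosine sum, each differentiation being a
    quarter-period shift. *)
Definition cos_sum_deriv c (j L : nat) x : R :=
  \sum_(m < L) c m * m%:R ^+ j * cos (m%:R * x + j%:R * (pi / 2)).

Lemma is_derive_cos_sum c j L x : is_derive x 1 (cos_sum_deriv c j L) (cos_sum_deriv c j.+1 L x).
Proof.
have -> : cos_sum_deriv c j L = \sum_(m < L) (fun y => c m * m%:R ^+ j * cos (m%:R * y + j%:R * (pi / 2))).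
  by apply/funext => y; rewrite fct_sumE.
apply: is_derive_sum => m.
set b := j%:R * (pi / 2).
have h1 : is_derive x 1 (fun y : R => m%:R * y + b) m%:R.
  by apply: is_derive_eq; rewrite addr0 /GRing.scale /= mulr1.
have h2 : is_derive x 1 (fun y : R => cos (m%:R * y + b)) (- sin (m%:R * x + b) * m%:R).
  exact: (is_derive1_comp (is_derive_cos _) h1).
have h3 := is_deriveZ (c m * m%:R ^+ j) h2.
apply: is_derive_eq h3 _.
have -> : m%:R * x + j.+1%:R * (pi / 2) = (m%:R * x + b) + pi / 2 by rewrite /b -natr1; ring.
by rewrite cosDpihalf exprS /GRing.scale /=; ring.
Qed.

Lemma continuous_cos_sum_deriv c j L : continuous (cos_sum_deriv c j L).
Proof.
move=> x; apply/differentiable_continuous/derivable1_diffP.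
by have [] := is_derive_cos_sum c j L x.
Qed.

(** All derivatives of the partial sums up to order [2 * k] converge
    uniformly.  That the sum of the series is [h] follows since partial sums
    and Fejer means differ by at most the sum of |a_m| m, divided by L. *)
Lemma fejer_limit_Cn k a h (C : R) : (0 < k)%N -> fejer_limit a h ->
  (forall n, \sum_(m < n) `|a m| * (m%:R ^+ 2) ^+ k <= C) -> Cn (2 * k) h.
Proof.
move=> k0 Ha HC.
pose b (m : nat) := 2 * (`|a m| * (m%:R ^+ 2) ^+ k).
pose c (m : nat) := cos_weight R m * a m.
have b0 m : 0 <= b m by rewrite !mulr_ge0 ?exprn_ge0 ?sqr_ge0.
have bC n : \sum_(m < n) b m <= 2 * C by rewrite -mulr_sumr ler_pM2l.
have em2 m : cos_weight R m <= 2 by rewrite /cos_weight; case: m => [|?]; lra.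
have cb j m : (j <= 2 * k)%N -> (0 < m)%N -> `|c m * m%:R ^+ j| <= b m.
  move=> jk m0; rewrite /b /c !normrM -mulrA (ger0_norm (cos_weight_ge0 R m)).
  apply: ler_pM; rewrite ?cos_weight_ge0 ?mulr_ge0 // ler_wpM2l //.
  by rewrite ger0_norm ?exprn_ge0 // -exprM ler_weXn2l // ler1n.
have [T T0 HT] := tail_rate b0 bC.
have Hd : forall j x, exists l, (j <= 2 * k)%N -> forall N, `|cos_sum_deriv c j N.+1 x - l| <= T N.
  move=> j x; case: (leqP j (2 * k)) => jk; last by exists 0.
  suff [l Hl] : exists l, forall N, `|cos_sum_deriv c j N.+1 x - l| <= T N by exists l.
  apply: limit_of_rate => N M; apply: (HT (fun m => c m * m%:R ^+ j * cos (m%:R * x + j%:R * (pi / 2)))) => m m0.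
  by rewrite normrM (le_trans _ (cb _ _ jk m0)) // ler_piMr // cos_max.
have Hd' j : exists dj : R -> R, forall x, (j <= 2 * k)%N ->
    forall N, `|cos_sum_deriv c j N.+1 x - dj x| <= T N.
  by have [dj Hdj] := choice (Hd j); exists dj.
have [d {Hd'}Hd''] := choice Hd'; move: Hd'' => {}Hd.
have dc j : (j <= 2 * k)%N -> continuous (d j).
  move=> jk; apply: (continuous_unif_lim T0 (fun N x => Hd j x jk N)) => N.
  exact: continuous_cos_sum_deriv.
have dd j : (j < 2 * k)%N -> forall x : R, is_derive x 1 (d j) (d j.+1 x).
  move=> jk; apply: (is_derive_unif_lim T0 (fun N x => Hd j x (ltnW jk) N) (fun N x => Hd j.+1 x jk N)).
    by move=> N x; exact: is_derive_cos_sum.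
  exact: dc.
have Hi i : (i <= 2 * k)%N -> Cn i (d (2 * k - i)%N).
  elim: i => [|i IH] ik; first by rewrite subn0 => x _; exact: dc.
  apply: (@Cn_is_derive _ _ _ (d (2 * k - i)%N)); last exact: IH (ltnW ik).
  move=> x _; have := dd (2 * k - i.+1)%N _ x.
  have -> : (2 * k - i.+1).+1 = (2 * k - i)%N by lia.
  by apply; lia.
have := Hi _ (leqnn _); rewrite subnn; apply: Cn_ext => x _.
apply/eqP; rewrite -subr_eq0 -normr_le0; apply/ler_addgt0Pr => eps eps0; rewrite add0r.
have e3 : 0 < eps / 3 by rewrite divr_gt0.
have C0 : 0 <= 2 * C by have := bC 0%N; rewrite big_ord0.
have [N0 HN0] := T0 _ e3; have [L0 HL0] := Ha _ e3; have [N1 HN1] := null_seq_inv C0 e3.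
pose N := maxn N0 (maxn L0 N1).
have {}HN0 : T N <= eps / 3 by apply: HN0; rewrite /N; lia.
have {}HL0 : `|fejer_sum N.+1 a x - h x| <= eps / 3 by apply: HL0; rewrite /N; lia.
have {}HN1 : 2 * C / N.+1%:R <= eps / 3 by apply: HN1; rewrite /N; lia.
have Hs : `|cos_sum_deriv c 0 N.+1 x - fejer_sum N.+1 a x| <= 2 * C / N.+1%:R.
  rewrite /cos_sum_deriv /fejer_sum -sumrB; apply: (le_trans (ler_norm_sum _ _ _)).
  rewrite ler_pdivlMr ?ltr0n // mulr_suml; apply: (le_trans _ (bC N.+1)).
  apply: ler_sum => m _.
  rewrite mul0r addr0 expr0 mulr1.
  have -> : c m * cos (m%:R * x) - cos_weight R m * (1 - m%:R / N.+1%:R) * (a m * cos (m%:R * x)) =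
     (c m * m%:R ^+ 1) / N.+1%:R * cos (m%:R * x) by rewrite /c; ring.
  rewrite normrM normrM (@ger0_norm _ (N.+1%:R^-1)) ?invr_ge0 // mulrAC divfK ?pnatr_eq0 //.
  case: (posnP m) => [m0|m0].
    by rewrite m0 mulr0 normr0 mul0r.
  rewrite (le_trans _ (cb 1%N m _ m0)) ?ler_piMr ?cos_max //; lia.
have {}HN2 := le_trans (Hd 0%N x isT N) HN0.
have {HN1}Hs := le_trans Hs HN1.
have -> : d 0%N x - h x = (cos_sum_deriv c 0 N.+1 x - fejer_sum N.+1 a x)
   + (fejer_sum N.+1 a x - h x) - (cos_sum_deriv c 0 N.+1 x - d 0%N x) by ring.
apply: (le_trans (ler_normB _ _)).
have -> : eps = eps / 3 + eps / 3 + eps / 3 by field.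
by rewrite lerD // (le_trans (ler_normD _ _)) // lerD.
Qed.

End CosineSeries.

(** * Profiles of isotropic kernels *)

Section Modulus.
Local Open Scope classical_set_scope.
Variable R : realType.
Implicit Types (psi : R -> R) (a b : R).

Lemma heine_cantor psi : {within `[0, pi], continuous psi} -> forall eps : R, 0 < eps ->
  exists2 dl : R, 0 < dl & forall a b, 0 <= a <= pi -> 0 <= b <= pi ->
    `|a - b| < dl -> `|psi a - psi b| <= eps.
Proof.
move=> pc eps eps0.
have e2 : 0 < eps / 2 by rewrite divr_gt0.
pose K : set R := `[0, pi]%classic.
have cK : compact K by exact: segment_compact.
move/compact_near_coveringP/near_covering_withinP : cK => /(_ R (0^'+)
   (fun dl a => forall b, K b -> `|a - b| < dl -> `|psi a - psi b| <= eps)) H.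
have : \forall dl \near 0^'+, K `<=` (fun a => forall b, K b -> `|a - b| < dl -> `|psi a - psi b| <= eps).
  apply: H => x Kx.
  have : \forall y \near within K (nbhs x), `|psi x - psi y| <= eps / 2.
    by have /subspace_continuousP/(_ x Kx)/cvgrPdist_le/(_ _ e2) := pc.
  rewrite /within /= => /nbhs_ballP[r /= r0 Hr].
  have r2 : 0 < r / 2 by rewrite divr_gt0.
  exists (ball x (r / 2), [set dl | dl < r / 2]); first split => /=.
  - exact: nbhsx_ballx.
  - exact: nbhs_right_lt.
  move=> [y dl] /= [yx dlr] Ky b Kb yb.
  have h1 : `|psi x - psi y| <= eps / 2.
    apply: Hr => //; apply: le_ball yx; lra.
  have h2 : `|psi x - psi b| <= eps / 2.
    apply: Hr => //; move: yx; rewrite /ball /= => yx.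
    have -> : x - b = (x - y) + (y - b) by ring.
    apply: le_lt_trans (ler_normD _ _) _; lra.
  have -> : psi y - psi b = (psi x - psi b) - (psi x - psi y) by ring.
  apply: (le_trans (ler_normB _ _)); lra.
move=> Hn.
have Hn2 : \forall dl \near (0:R)^'+, 0 < dl by exact: nbhs_right_gt.
have [dl [dl0 Hdl]] := filter_ex (filterI Hn2 Hn).
exists dl => // a b a0 b0 ab; by apply: Hdl => //=; rewrite in_itv.
Qed.
Lemma bounded_profile psi : {within `[0, pi], continuous psi} ->
  exists2 B : R, 0 <= B & forall a, 0 <= a <= pi -> `|psi a| <= B.
Proof.
move=> pc; have [c1 _ H1] := EVT_max (pi_ge0 R) pc.
have [c2 _ H2] := EVT_min (pi_ge0 R) pc.
exists (`|psi c1| + `|psi c2|); first by rewrite addr_ge0.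
move=> a api; have h1 := H1 a; have h2 := H2 a.
rewrite !in_itv /= api in h1 h2; have {}h1 := h1 isT; have {}h2 := h2 isT.
have := ler_norm (psi c1); have := ler_norm (- psi c2); rewrite normrN.
have := normr_ge0 (psi c1); have := normr_ge0 (psi c2).
by move=> *; rewrite ler_norml; apply/andP; split; lra.
Qed.

(** From [cos a - cos b = 2 sin ((a + b) / 2) sin ((b - a) / 2)], where both
    arguments stay away from 0 and pi. *)
Lemma cos_separates (dl : R) : 0 < dl -> exists2 c : R, 0 < c &
  forall a b, 0 <= a <= pi -> 0 <= b <= pi -> dl <= `|a - b| -> c <= (cos a - cos b) ^+ 2.
Proof.
move=> dl0; have [dlp|pdl] := leP dl pi; last first.
  exists 1 => // a b /andP[a0 a1] /andP[b0 b1] ab; exfalso.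
  have : `|a - b| <= pi; last by lra.
  by rewrite ler_norml; apply/andP; split; lra.
have s0 : 0 < sin (dl / 2) by apply: sin_gt0_pi; have := pi_gt0 R; lra.
exists ((2 * sin (dl / 2) ^+ 2) ^+ 2); first by rewrite exprn_gt0 // mulr_gt0 // exprn_gt0.
move=> a b.
wlog ab : a b / a <= b.
  move=> H ha hb h; case: (leP a b) => [|/ltW] ab; first exact: H.
  by rewrite -[leRHS]sqrrN opprB; apply: H => //; rewrite distrC.
move=> /andP[a0 a1] /andP[b0 b1]; rewrite distrC ger0_norm ?subr_ge0 // => h.
have slow (y : R) : dl / 2 <= y <= pi - dl / 2 -> sin (dl / 2) <= sin y.
  move=> /andP[y0 y1]; have [yp|yp] := leP y (pi / 2).
    by have [->//|yn] := eqVneq (dl / 2) y; rewrite ltW // ltr_sin ?in_itv /=; lra.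
  have -> : sin y = sin (pi - y) by rewrite sinB cospi sinpi; ring.
  by have [->//|yn] := eqVneq (dl / 2) (pi - y); rewrite ltW // ltr_sin ?in_itv /=; lra.
have E : cos a - cos b = 2 * (sin ((a + b) / 2) * sin ((b - a) / 2)).
  set u := (a + b) / 2; set v := (b - a) / 2.
  have -> : cos a = cos (u - v) by congr cos; rewrite /u /v; field.
  have -> : cos b = cos (u + v) by congr cos; rewrite /u /v; field.
  by rewrite cosB cosD; ring.
rewrite E; apply: lerXn2r; rewrite ?nnegrE ?mulr_ge0 ?exprn_ge0 ?(ltW s0) //.
- by apply: sin_ge0_pi; lra.
- by apply: sin_ge0_pi; lra.
rewrite ler_wpM2l // expr2; apply: ler_pM; rewrite ?(ltW s0) //; apply: slow; lra.
Qed.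

Definition profile psi : R -> R := fun x => psi (acos (cos x)).

Lemma cos_itv (x : R) : -1 <= cos x <= 1. Proof. by rewrite cos_geN1 cos_le1. Qed.

(** The bound
    (cos t - cos x)^2 <= 2 (1 - cos(x - t)) turns the modulus of continuity on
    [0, pi] into the one that Fejer kernels use. *)
Lemma profile_modulus psi : {within `[0, pi], continuous psi} -> forall e : R, 0 < e ->
  exists2 C : R, 0 <= C & forall x t, `|profile psi t - profile psi x| <= e + C * (1 - cos (x - t)).
Proof.
move=> pc e e0; have [dl dl0 Hdl] := heine_cantor pc e0; have [B B0 HB] := bounded_profile pc.
have [c c0 Hc] := cos_separates dl0.
exists (2 * (2 * B / c)); first by rewrite !mulr_ge0 // invr_ge0 ltW.
move=> x t; rewrite /profile.
have acI (y : R) : 0 <= acos (cos y) <= pi 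
  by apply/andP; split; [apply: acos_ge0|apply: acos_lepi]; exact: cos_itv.
have C1 : 0 <= 1 - cos (x - t) by rewrite subr_ge0 cos_le1.
have [h|h] := ltP `|acos (cos t) - acos (cos x)| dl.
  by apply: (le_trans (Hdl _ _ (acI t) (acI x) h)); rewrite lerDl !mulr_ge0 // invr_ge0 ltW.
have := Hc _ _ (acI t) (acI x) h; rewrite !acosK ?in_itv /= ?cos_itv // => hc.
have hs : (cos t - cos x) ^+ 2 <= 2 * (1 - cos (x - t)).
  have := cos2Dsin2 x; have := cos2Dsin2 t; have := sqr_ge0 (sin x - sin t).
  rewrite cosB !sqrrB; lra.
apply: (@le_trans _ _ (2 * B)).
  by apply: (le_trans (ler_normB _ _)); have := HB _ (acI t); have := HB _ (acI x); lra.
apply: (@le_trans _ _ (2 * B / c * (2 * (1 - cos (x - t))))).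
  rewrite -mulrA ler_peMr ?mulr_ge0 //.
  by rewrite ler_pdivlMl // mulr1 (le_trans hc).
have -> : 2 * B / c * (2 * (1 - cos (x - t))) = 2 * (2 * B / c) * (1 - cos (x - t)) by ring.
by rewrite lerDr ltW.
Qed.

Lemma weierstrass_profile psi : {within `[0, pi], continuous psi} -> forall e : R, 0 < e ->
  exists p : {poly R}, forall t, -1 <= t <= 1 -> `|p.[t] - psi (acos t)| <= e.
Proof.
move=> pc e e0; have e2 : 0 < e / 2 by rewrite divr_gt0.
have [C C0 H] := profile_modulus pc e2.
have [p Hp] := weierstrass_cos e2 C0 (fun x => congr1 psi (congr1 (@acos R) (cosN x))) H.
exists p => t t1; have := Hp (acos t); rewrite /profile acosK ?in_itv //.
by have -> : e / 2 + e / 2 = e by field.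
Qed.

End Modulus.

Section Coordinates.
Local Open Scope classical_set_scope.
Variable R : realType.
Implicit Types (x y : seq (R * R)).

Fixpoint coords x : seq R :=
  if x is a :: x' then a.1 * cos a.2 :: a.1 * sin a.2 :: coords x' else [::].

Definition vec (d : nat) x : 'rV[R]_d.+1 := \row_i (coords x)`_i.

Lemma inner_vec d x y : size x = size y -> (2 * size x <= d.+1)%N ->
  inner (vec d x) (vec d y) = dot x y.
Proof.
rewrite /inner; under eq_bigr do rewrite !mxE.
move: d.+1 => m; elim: x y m => [|a x IH] [|b y] // m.
  by move=> _ _ /=; rewrite big1 // => i _; rewrite nth_nil mul0r.
move=> [sxy]; rewrite /= mulnS; case: m => [|[|m]] // hm.
rewrite -(IH _ m sxy) //.
rewrite !big_ord_recl addrA; congr (_ + _).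
by rewrite /= cosB; ring.
Qed.

Lemma dotxx x : dot x x = normsq x.
Proof.
elim: x => [|a x IH] /=; first by rewrite /normsq big_nil.
by rewrite normsq_cons IH subrr cos0 mulr1.
Qed.

(** The unit sphere of C^(k+1) embeds isometrically in S^d when
    [2 * (k + 1) <= d + 1]. *)
Lemma Psi_pd_profile d k (psi : R -> R) : (2 * k.+1 <= d.+1)%N -> Psi d psi ->
  pd_profile k (fun t => psi (acos t)).
Proof.
move=> kd [_ _ pd] s hs.
pose p0 : R * seq (R * R) := (0, [::]).
have hi (i : 'I_(size s)) : on_sphere k (nth p0 s i).2 by apply: hs; exact: mem_nth.
have := pd (size s) (fun i => vec d (nth p0 s i).2) (fun i => (nth p0 s i).1).
have H : forall i : 'I_(size s), @sphere R d (vec d (nth p0 s i).2).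
  move=> i; have [si ni] := hi i.
  by rewrite /sphere /= /enorm inner_vec ?si // dotxx ni sqrtr1.
move=> /(_ H); congr (_ <= _).
rewrite (big_nth p0) big_mkord; apply: eq_bigr => i _.
rewrite (big_nth p0) big_mkord; apply: eq_bigr => j _.
have [si _] := hi i; have [sj _] := hi j.
by rewrite /geodist inner_vec ?si ?sj.
Qed.
End Coordinates.

(** * The expansion of a profile and its smoothness *)

Section Assembly.
Variable R : realType.
Implicit Types (x t : R) (a : nat -> R).

Lemma fejer_sum_diff L a c (r : R) x : (forall m, `|a m - c m| <= r) ->
  `|fejer_sum L a x - fejer_sum L c x| <= 2 * L%:R * r.
Proof.
move=> H; rewrite /fejer_sum -sumrB; apply: (le_trans (ler_norm_sum _ _ _)).
have -> : 2 * L%:R * r = \sum_(m < L) 2 * r by rewrite sumr_const card_ord -[_ *+ L]mulr_natl; ring.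
apply: ler_sum => m _.
have -> : cos_weight R m * (1 - m%:R / L%:R) * (a m * cos (m%:R * x)) -
  cos_weight R m * (1 - m%:R / L%:R) * (c m * cos (m%:R * x)) =
  cos_weight R m * (1 - m%:R / L%:R) * ((a m - c m) * cos (m%:R * x)) by ring.
have f0 := fejer_weight_ge0 R m.
have f1 : 1 - m%:R / L%:R <= 1 :> R by rewrite lerBlDr lerDl divr_ge0.
have em2 : cos_weight R m <= 2 by rewrite /cos_weight; case: (nat_of_ord m) => [|?]; lra.
rewrite normrM; apply: ler_pM => //.
  rewrite ger0_norm ?mulr_ge0 ?cos_weight_ge0 // -[leRHS]mulr1; apply: ler_pM => //; exact: cos_weight_ge0.
by apply: le_trans (H m); rewrite normrM ler_piMr // cos_max.
Qed.

(** The arithmetic-geometric inequality turns the Lipschitz bound of [Q] into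
    the quadratic modulus required by Fejer approximation, with no dependence
    on the degree of [Q]. *)
Lemma fejer_sum_lipschitz (Q : {poly R}) (D e : R) L x : 0 < e -> 0 <= D -> (0 < L)%N ->
  (forall t, -1 <= t <= 1 -> `|Q^`().[t]| <= D) ->
  `|fejer_sum L (fcoef Q) x - Q.[cos x]| <= e + D ^+ 2 / e / L%:R.
Proof.
move=> e0 D0 L0 HQ.
rewrite -(@avg_fejer_poly R (L + size Q).+1) //.
have -> : D ^+ 2 / e / L%:R = 2 * (D ^+ 2 / (2 * e)) / L%:R.
  by congr (_ / _); field; rewrite lt0r_neq0.
apply: (@fejer_approx R _ _ (fun t => Q.[cos t])).
- by rewrite L0 -addnS leq_addr.
- by rewrite divr_ge0 ?exprn_ge0 ?mulr_ge0 // ltW.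
move=> t; apply: (le_trans (poly_lipschitz HQ (cos_itv t) (cos_itv x))).
set u := `|cos t - cos x|.
have hs : u ^+ 2 <= 2 * (1 - cos (x - t)).
  rewrite real_normK ?num_real //.
  have := cos2Dsin2 x; have := cos2Dsin2 t; have := sqr_ge0 (sin x - sin t).
  rewrite cosB !sqrrB; lra.
apply: (@le_trans _ _ (e + D ^+ 2 / (4 * e) * u ^+ 2)).
  rewrite -subr_ge0.
  have -> : e + D ^+ 2 / (4 * e) * u ^+ 2 - D * u = (2 * e - D * u) ^+ 2 / (4 * e).
    by field; rewrite lt0r_neq0.
  by rewrite divr_ge0 ?sqr_ge0 // mulr_ge0 // ltW.
rewrite lerD2l.
have -> : D ^+ 2 / (2 * e) * (1 - cos (x - t)) = D ^+ 2 / (4 * e) * (2 * (1 - cos (x - t))).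
  by field; rewrite lt0r_neq0.
by rewrite ler_wpM2l // divr_ge0 ?sqr_ge0 // mulr_ge0 // ltW.
Qed.

Lemma one_subX_le j k t : (j <= k)%N -> -1 <= t <= 1 -> (1 - t) ^+ j <= 2 ^+ k.
Proof.
move=> jk /andP[t0 t1]; apply: (@le_trans _ _ (2 ^+ j)); last by rewrite ler_weXn2l // ler1n.
by apply: lerXn2r; rewrite ?nnegrE; lra.
Qed.

(** Here [q N] are polynomials approximating [psi o acos], [G j N] their
    j-fold primitives, [h j] the limit of [G j N] o cos and [a] the limit of
    the Fourier coefficients of [G k N]. *)
Lemma Cn_pd_profile k (psi : R -> R) : (0 < k)%N -> ({within `[0, pi], continuous psi})%classic ->
  pd_profile k (fun t => psi (acos t)) -> Cn k psi.
Proof.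
move=> k0 pc pd; pose g t := psi (acos t).
pose e (N : nat) : R := N.+1%:R^-1.
have e0 N : 0 < e N by rewrite invr_gt0 ltr0n.
have [q Hq] := choice (fun N => weierstrass_profile pc (e0 N)).
pose E (N : nat) : R := 2 ^+ k / N.+1%:R.
have E0 : null_seq E by apply: null_seq_inv; rewrite exprn_ge0.
have p2 : (1 : R) <= 2 ^+ k by rewrite exprn_ege1 // ler1n.
have eE N : e N <= E N by rewrite /E /e ler_peMl // invr_ge0.
have [B B0 HB] := bounded_profile pc.
have gB t : -1 <= t <= 1 -> `|g t| <= B.
  by move=> ht; apply: HB; apply/andP; split; [exact: acos_ge0 | exact: acos_lepi].
have qB N t : -1 <= t <= 1 -> `|(q N).[t]| <= B + 1.
  move=> ht; have -> : (q N).[t] = ((q N).[t] - g t) + g t by ring.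
  apply: (le_trans (ler_normD _ _)); rewrite [leRHS]addrC lerD ?gB //.
  by apply: (le_trans (Hq N t ht)); rewrite invf_le1 ?ltr0n // ler1n.
have q12 N M t : -1 <= t <= 1 -> `|(q N).[t] - (q M).[t]| <= e N + e M.
  move=> ht; have -> : (q N).[t] - (q M).[t] = ((q N).[t] - g t) - ((q M).[t] - g t) by ring.
  by apply: (le_trans (ler_normB _ _)); rewrite lerD ?Hq.
pose G (j N : nat) := iter j (@prim R) (q N).
have GE j N M t : (j <= k)%N -> -1 <= t <= 1 -> `|(G j N).[t] - (G j M).[t]| <= E N + E M.
  move=> jk ht; rewrite /G; apply: (le_trans (iter_prim_diff j (q12 N M) ht)).
  rewrite /E -mulrDr mulrC; apply: ler_wpM2r; first by rewrite addr_ge0 ?ltW.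
  exact: one_subX_le.
(* [E] bounds the distance to the limit for all orders [j <= k] at once. *)
have Hh j : exists hj : R -> R, forall x, (j <= k)%N -> forall N, `|(G j N).[cos x] - hj x| <= E N.
  have H x : exists l, (j <= k)%N -> forall N, `|(G j N).[cos x] - l| <= E N.
    case: (leqP j k) => jk; last by exists 0.
    suff [l Hl] : exists l, forall N, `|(G j N).[cos x] - l| <= E N by exists l.
    by apply: limit_of_rate => N M; apply: GE => //; exact: cos_itv.
  by have [hj Hj] := choice H; exists hj.
have [h {}Hh] := choice Hh.
have Ha m : exists l, forall N, `|fcoef (G k N) m - l| <= E N.
  apply: limit_of_rate => N M; rewrite -fcoefN -fcoefD; apply: le_fcoef => t ht.
  by rewrite hornerD hornerN GE.
have [a {}Ha] := choice Ha.
(* The derivative of [G k N] is a (k - 1)-fold primitive of a bounded polynomial,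
   so [D] is a Lipschitz constant that does not depend on [N]. *)
have Glim : fejer_limit a (h k).
  move=> eps eps0; have e4 : 0 < eps / 4 by rewrite divr_gt0.
  pose D := (B + 1) * 2 ^+ k.
  have D0 : 0 <= D by rewrite mulr_ge0 ?exprn_ge0 ?addr_ge0.
  have D1 : 0 <= D ^+ 2 / (eps / 4) by rewrite divr_ge0 ?sqr_ge0 // ltW.
  have [L0 HL0] := null_seq_inv D1 e4.
  exists L0.+1 => L L0L x.
  have L1 : (0 < L)%N by lia.
  have {}HL0 : D ^+ 2 / (eps / 4) / L%:R <= eps / 4.
    by have := HL0 L.-1; rewrite prednK //; apply; lia.
  have HE : null_seq (fun N => (2 * L%:R + 1) * 2 ^+ k / N.+1%:R : R).
    by apply: null_seq_inv; rewrite mulr_ge0 ?exprn_ge0 // addr_ge0 // mulr_ge0.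
  have [N /(_ _ (leqnn N)) HN] := HE _ e4.
  have H1 : `|fejer_sum L a x - fejer_sum L (fcoef (G k N)) x| <= 2 * L%:R * E N.
    by apply: fejer_sum_diff => m; rewrite distrC.
  have H2 : `|fejer_sum L (fcoef (G k N)) x - (G k N).[cos x]| <= eps / 4 + eps / 4.
    apply: le_trans (_ : _ <= eps / 4 + D ^+ 2 / (eps / 4) / L%:R) _; last by rewrite lerD2l.
    apply: fejer_sum_lipschitz => // t ht.
    have [k' kE] : exists k', k = k'.+1 by case: (k) k0 => // k' _; exists k'.
    rewrite /G kE iterS deriv_prim; apply: (le_trans (iter_prim_bound k' (qB N) ht)).
    by rewrite ler_wpM2l ?addr_ge0 // one_subX_le // kE.
  have H3 := Hh k x (leqnn k) N.
  have H4 : 2 * L%:R * E N + E N <= eps / 4.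
    by have -> : 2 * L%:R * E N + E N = (2 * L%:R + 1) * 2 ^+ k / N.+1%:R by rewrite /E; ring.
  have -> : fejer_sum L a x - h k x = (fejer_sum L a x - fejer_sum L (fcoef (G k N)) x) +
     (fejer_sum L (fcoef (G k N)) x - (G k N).[cos x]) + ((G k N).[cos x] - h k x) by ring.
  apply: (le_trans (ler_normD _ _)).
  apply: (le_trans (lerD (ler_normD _ _) (lexx _))).
  move: H1 H2 H3 H4; lra.
have apos m : (k <= m)%N -> 0 <= a m.
  move=> km; have [C C0 HC] := fcoef_ge0_approx (m - k) pd.
  have CE : null_seq (fun N => ((C + 1) * 2 ^+ k) / N.+1%:R).
    by apply: null_seq_inv; rewrite mulr_ge0 ?addr_ge0 ?exprn_ge0.
  apply: (le_null CE) => N.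
  have := HC (G k N) (e N) (e0 N); rewrite derivn_iter_prim subnK // => /(_ (Hq N)).
  have := Ha m N; rewrite ler_norml => /andP[_ h1] h2.
  have h3 : C * e N <= C * E N by rewrite ler_wpM2l.
  have -> : (C + 1) * 2 ^+ k / N.+1%:R = C * E N + E N by rewrite /E; ring.
  move: h1 h2 h3; lra.
have hB x : `|h k x| <= (B + 1) * (1 - cos x) ^+ k.
  apply: (le_null E0) => N.
  have -> : h k x = (G k N).[cos x] - ((G k N).[cos x] - h k x) by ring.
  apply: (le_trans (ler_normB _ _)); apply: lerD; last exact: Hh.
  by apply: iter_prim_bound; [exact: qB | exact: cos_itv].
have [C HC] := fejer_limit_summable (addr_ge0 B0 ler01) Glim apos hB.
have hkC := fejer_limit_Cn k0 Glim HC.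
have hc j : (j <= k)%N -> continuous (h j).
  move=> jk; apply: (continuous_unif_lim E0 (fun N x => Hh j x jk N)) => N x.
  exact: (continuous_comp (@continuous_cos R x) (@continuous_horner R (G j N) (cos x))).
have hd j : (j < k)%N -> forall x : R, is_derive x 1 (h j.+1) (-1 * sin x * h j x).
  move=> jk.
  apply: (is_derive_unif_lim (G := fun N x => -1 * sin x * (G j N).[cos x]) E0
     (fun N x => Hh j.+1 x jk N)).
  - move=> N x; rewrite -mulrBr normrM (le_trans _ (Hh j x (ltnW jk) N)) // ler_piMl //.
    by rewrite mulN1r normrN sin_max.
  - move=> N x; have := is_derive1_comp (is_derive_poly (G j.+1 N) (cos x)) (is_derive_cos x).
    by rewrite /G /= deriv_prim => H; apply: is_derive_eq H _; ring.
  - move=> x; apply: cvgM; last exact: hc (ltnW jk) x.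
    by apply: cvgM; [exact: cvg_cst | exact: continuous_sin].
(* Going down one primitive means differentiating and dividing by [- sin]. *)
have Hi i : (i <= k)%N -> Cn (2 * k - i) (h (k - i)%N).
  elim: i => [|i IH] ik; first by rewrite !subn0.
  have := IH (ltnW ik).
  have -> : (2 * k - i = (2 * k - i.+1).+1)%N by lia.
  have -> : (k - i = (k - i.+1).+1)%N by lia.
  have jk : (k - i.+1 < k)%N by lia.
  move=> /(Cn_derive (fun x _ => hd _ jk x)) H.
  apply: (@Cn_ext _ _ (fun x => (-1 * (sin x)^-1) * (-1 * sin x * h (k - i.+1)%N x))); last first.
    by apply: CnM H; apply: CnM; [exact: Cn_cst | exact: Cn_sinV].
  by move=> x xI /=; field; exact: sin_neq0.
have := Hi k (leqnn k); rewrite subnn mul2n -addnn addnK.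
apply: Cn_ext => x; rewrite in_itv /= => /andP[x0 xpi].
have xE : acos (cos x) = x by rewrite cosK // in_itv /= !ltW.
apply/eqP; rewrite -subr_eq0 -normr_le0.
have EE : null_seq (fun N => 2 ^+ k * 2 / N.+1%:R : R) by apply: null_seq_inv; rewrite mulr_ge0 ?exprn_ge0.
apply: (le_null EE) => N; rewrite add0r.
have -> : h 0%N x - psi x = ((q N).[cos x] - psi x) - ((G 0%N N).[cos x] - h 0%N x) by rewrite /G /=; ring.
apply: (le_trans (ler_normB _ _)).
have H1 := Hh 0%N x isT N.
have H2 := Hq N _ (cos_itv x); rewrite xE in H2.
have H3 := eE N.
have -> : 2 ^+ k * 2 / N.+1%:R = E N + E N by rewrite /E; ring.
by rewrite lerD // (le_trans H2).
Qed.

End Assembly.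

Theorem theorem1p2 (R : realType) (d : nat) (hd : (1 <= d)%N)
    (psi : R -> R) (hpsi : Psi d psi) :
  has_continuous_derivative ((d - 1) %/ 2)%N 0%R pi psi.
Proof.
apply: has_continuous_derivative_Cn; have [pc _ _] := hpsi.
have [k0|k0] := posnP ((d - 1) %/ 2)%N.
  rewrite k0 => x xI; exact: (within_continuous_continuous (pi_gt0 R) pc).
apply: Cn_pd_profile => //; apply: Psi_pd_profile hpsi.
by lia.
Qed.
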